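(* Let $d\ge 1$ be an integer and let $\alpha_1,\dots,\alpha_d$ be real numbers with $\alpha_i>-1$ for all $i\in\{1,2,\dots,d\}$. Then the radius of starlikeness $r^{\star}(f_{\alpha})$ of the normalized hyper-Bessel function $f_{\alpha}(z)=z\mathcal{J}_{\alpha}(z)$ is the smallest positive root of the equation $$z\mathcal{J}_{\alpha}'(z)+\mathcal{J}_{\alpha}(z)=0,$$ and it satisfies the inequalities $$r^{\star}(f_{\alpha})<\sqrt[d+1]{(d+1)^d A(\alpha)}$$ and $$\frac{(d+1)^{d+1}A(\alpha)}{d+2}<\left(r^{\star}(f_{\alpha})\right)^{d+1}<\frac{(d+2)(d+1)^{d+1}A(\alpha)B(\alpha)}{(d+2)^{2}B(\alpha)-(2d+3)A(\alpha)}.$$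
   Context: Write $\alpha=(\alpha_1,\dots,\alpha_d)$. The normalized hyper-Bessel function is the entire function $$\mathcal{J}_{\alpha}(z)=\sum_{n\ge 0}\frac{(-1)^n}{n!\,(\alpha_1+1)_n\cdots(\alpha_d+1)_n}\left(\frac{z}{d+1}\right)^{n(d+1)},$$ where $(\beta)_0=1$ and $(\beta)_n=\beta(\beta+1)\cdots(\beta+n-1)$ for $n\ge1$. Set $f_{\alpha}(z)=z\mathcal{J}_{\alpha}(z)$, $A(\alpha)=\prod_{i=1}^d(\alpha_i+1)$ and $B(\alpha)=\prod_{i=1}^d(\alpha_i+2)$. For an analytic function $f$ with $f(0)=f'(0)-1=0$, the radius of starlikeness is $$r^{\star}(f)=\sup\left\{r>0:\ \operatorname{Re}\left(\frac{zf'(z)}{f(z)}\right)>0\ \text{for all } z\in\mathbb{D}_r\right\},\qquad \mathbb{D}_r=\{z\in\mathbb{C}:|z|<r\},$$ where $zf'(z)/f(z)$ takes the value $1$ at $z=0$ (removable singularity), and the condition requires $f(z)\ne0$ for $z\in\mathbb{D}_r\setminus\{0\}$. *)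

(* Defs.v *)
From HB Require Import structures.
From mathcomp Require Import all_boot all_order all_algebra.
From mathcomp Require Import complex.
From mathcomp Require Import all_classical all_reals all_analysis.

Set Implicit Arguments.
Unset Strict Implicit.
Unset Printing Implicit Defensive.

Import Order.TTheory GRing.Theory Num.Theory.
Import numFieldNormedType.Exports.

Local Open Scope classical_set_scope.
Local Open Scope complex_scope.
Local Open Scope ring_scope.

(* [R[i]] as a normed module over itself, topologized by its modulus: for
   [f : Cplx R -> Cplx R], [derive1 f] is the complex derivative.  The modulus
   [`|z|] is itself an element of [R[i]], hence the comparisons of the form
   [`|z| < r%:C]. *)
Notation Cplx R := ((R[i] : numFieldType)^o).

Definition pochhammer (F : nzRingType) (b : F) (n : nat) : F :=
  \prod_(0 <= k < n) (b + k%:R).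

Section HyperBessel.
Variables (R : realType) (d : nat) (alpha : 'I_d -> R).

Definition hyper_bessel_coef (n : nat) : R :=
  (-1) ^+ n / (n`!%:R * \prod_(i < d) pochhammer (alpha i + 1) n).

(* The limit of the partial sums exists for every [z] as soon as no [alpha i]
   is a negative integer. *)
Definition hyper_bessel (z : Cplx R) : Cplx R :=
  limn (series (fun n : nat =>
    (hyper_bessel_coef n)%:C * (z / d.+1%:R) ^+ (n * d.+1)) : nat -> Cplx R).

Definition hyper_bessel_f (z : Cplx R) : Cplx R := z * hyper_bessel z.

Definition prodA : R := \prod_(i < d) (alpha i + 1).

Definition prodB : R := \prod_(i < d) (alpha i + 2).

End HyperBessel.

Section Starlikeness.
Variable R : realType.
Implicit Types (f g : Cplx R -> Cplx R) (r : R).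

(* The value at the removable singularity [0] is set to [1]. *)
Definition starlike_quotient f (z : Cplx R) : Cplx R :=
  if z == 0 then 1 else z * derive1 f z / f z.

(* Since division by zero is total, the nonvanishing of [f] off the origin is
   required explicitly. *)
Definition starlike_on_disc f r : Prop :=
  forall z : Cplx R, `|z| < r%:C ->
    (z != 0 -> f z != 0) /\ 0 < complex.Re (starlike_quotient f z).

(* The supremum is taken in the extended reals, where it is meaningful for
   unbounded sets of radii. *)
Definition starlikeness_radius f : \bar R :=
  ereal_sup [set r%:E | r in [set r : R | 0 < r /\ starlike_on_disc f r]].

Definition is_smallest_positive_root g r : Prop :=
  [/\ 0 < r, g r%:C = 0 & forall s : R, 0 < s -> g s%:C = 0 -> r <= s].

End Starlikeness.

(* Main.v *)
Require Import Defs.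
From HB Require Import structures.
From mathcomp Require Import all_boot all_order all_algebra.
From mathcomp Require Import complex.
From mathcomp Require Import all_classical all_reals all_analysis.
From mathcomp Require Import ring lra zify.

Set Implicit Arguments.
Unset Strict Implicit.
Unset Printing Implicit Defensive.

Import Order.TTheory GRing.Theory Num.Theory.
Import numFieldNormedType.Exports.

Local Open Scope classical_set_scope.
Local Open Scope complex_scope.
Local Open Scope ring_scope.

(** Put [w = (z / (d + 1)) ^ (d + 1)] and write [J z = phi w] with
    [phi w = sum_k phi_k w ^ k].  Then [f' z = psi w] where
    [psi = phi + (d + 1) w phi'], and for [z != 0],
    [z f' z / f z = psi w / phi w = 1 - (d + 1) w T_1 w] with [T_1 = - phi' / phi].

    Everything rests on the nonnegativity of the Taylor coefficients of [T_1],
    obtained without any factorization of [phi].  With [D = w d/dw], [beta_0 = 1]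
    and [beta_i = alpha_i + 1], the functions [Q_i] given by [Q_(d+1) = phi] and
    [(D + beta_i) Q_i = Q_(i+1)] satisfy [phi' = - Q_1] and [phi = 1 - w Q_0], so
    that the quotients [T_i = Q_i / phi] solve
    [(D + beta_i) T_i = T_(i+1) + w T_1 T_i] with [T_(d+1) = 1], a system whose
    formal solution has nonnegative coefficients.  A minimum principle for
    [D + beta] bounds the partial sums of [T_i] by [Q_i / phi] on a real interval
    where [phi > 0], so the series [T_0] and [T_1] converge on the corresponding
    disc; there [phi] has no zero (at a zero, [Q_0 = phi T_0] would vanish too,
    against [phi = 1 - w Q_0]) and [|T_1 w| <= T_1 |w|].  Hence
    [Re (psi / phi) > 0] on the disc of radius [rho], the first positive zero of
    [psi]; at [rho] itself [f'] vanishes.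

    The bound [(d + 1) rho < A] follows from the first two coefficients of [T_1],
    the two others from truncations of the alternating series [psi]. *)

(** * Formal power series and the Riccati system *)

Section FormalSeries.
Variable F : comNzRingType.
Implicit Types a b c : nat -> F.

Definition conv a b n := \sum_(j < n.+1) a j * b (n - j)%N.
Definition euler a n := n%:R * a n.
Definition mulX a n := if n is n'.+1 then a n' else 0.
Definition one_series n : F := (n == 0)%N%:R.

Lemma conv_coefM a b n N M : (n < N)%N -> (n < M)%N ->
  conv a b n = (\poly_(i < N) a i * \poly_(i < M) b i)`_n.
Proof.
move=> nN nM; rewrite coefM; apply: eq_bigr => j _; rewrite !coef_poly.
rewrite (leq_ltn_trans _ nN); last by rewrite -ltnS.
by rewrite (leq_ltn_trans (leq_subr _ _) nM).
Qed.

Lemma convC a b : conv a b = conv b a.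
Proof.
by apply/funext => n; rewrite (@conv_coefM _ _ _ n.+1 n.+1)// mulrC -conv_coefM.
Qed.

Lemma convA a b c : conv a (conv b c) = conv (conv a b) c.
Proof.
apply/funext => n; set p := fun u : nat -> F => \poly_(i < n.+1) u i.
transitivity ((p a * (p b * p c))`_n).
  rewrite coefM; apply: eq_bigr => j _; rewrite coef_poly ltn_ord.
  by rewrite (@conv_coefM b c _ n.+1 n.+1)// ltnS leq_subr.
rewrite mulrA coefM; apply: eq_bigr => j _; rewrite [in (p c)`__]coef_poly.
by rewrite ltnS leq_subr (@conv_coefM a b _ n.+1 n.+1).
Qed.

Lemma conv1s a : conv one_series a = a.
Proof.
apply/funext => n; rewrite /conv big_ord_recl /one_series eqxx mul1r subn0.
by rewrite big1 ?addr0// => i _; rewrite /= mul0r.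
Qed.

Lemma conv_mulXl a b : conv (mulX a) b = mulX (conv a b).
Proof.
apply/funext => -[|n]; first by rewrite /conv big_ord1 mul0r.
rewrite /conv big_ord_recl /= mul0r add0r; apply: eq_bigr => i _.
by rewrite /= /bump add1n subSS.
Qed.

Lemma conv_euler a b n :
  euler (conv a b) n = conv (euler a) b n + conv a (euler b) n.
Proof.
rewrite /euler /conv mulr_sumr -big_split; apply: eq_bigr => j _ /=.
have -> : n%:R = j%:R + (n - j)%:R :> F by rewrite -natrD subnKC// -ltnS.
by ring.
Qed.

(** Each coefficient of the reciprocal depends on all earlier ones, so they are kept in a list. No
    division by [a 0] takes place: the result is the reciprocal when [a 0 = 1]. *)
Fixpoint inv_prefix a n : seq F :=
  if n is n'.+1 then
    let s := inv_prefix a n' in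
    rcons s (one_series n' - \sum_(j < n') a (n' - j)%N * s`_j)
  else [::].
Definition inv_series a n := (inv_prefix a n.+1)`_n.

Lemma size_inv_prefix a n : size (inv_prefix a n) = n.
Proof. by elim: n => //= n IH; rewrite size_rcons IH. Qed.

Lemma nth_inv_prefix a n j : (j < n)%N -> (inv_prefix a n)`_j = inv_series a j.
Proof.
elim: n => // n IH; rewrite ltnS leq_eqVlt => /predU1P[->//|jn].
by rewrite -IH//= nth_rcons size_inv_prefix jn.
Qed.

Lemma conv_inv_series a : a 0 = 1 -> conv a (inv_series a) = one_series.
Proof.
move=> a0; rewrite convC; apply/funext => n.
rewrite /conv big_ord_recr /= subnn a0 mulr1.
rewrite [in X in _ + X]/inv_series /= nth_rcons size_inv_prefix ltnn eqxx addrC.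
rewrite [X in _ - X](_ : _ = \sum_(j < n) inv_series a j * a (n - j)%N) ?subrK//.
by apply: eq_bigr => j _; rewrite nth_inv_prefix// mulrC.
Qed.

End FormalSeries.
Arguments one_series {F}.

Section Riccati.
Variables (R : realFieldType) (m : nat) (beta : nat -> R).
Hypotheses (m_gt1 : (1 < m)%N) (beta0 : beta 0 = 1) (beta_gt0 : forall i, 0 < beta i).

(** When [beta 0 = 1], the factors with [i = 0] multiply to [k!] and the others to the Pochhammer
    symbols of the [beta i]. *)
Definition phi k : R :=
  (-1) ^+ k / \prod_(0 <= j < k) \prod_(0 <= i < m) (beta i + j%:R).
(* [qcoef i] and [tcoef i] are the Taylor coefficients of [Q_i] and [T_i]. *)
Definition qcoef i k : R := phi k / \prod_(i <= j < m) (beta j + k%:R).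
Definition tcoef i := conv (qcoef i) (inv_series phi).

Lemma betaD_gt0 i k : 0 < beta i + k%:R.
Proof. by rewrite ltr_wpDr. Qed.

Lemma prod_betaD_gt0 i k : 0 < \prod_(i <= j < m) (beta j + k%:R).
Proof. by apply: prodr_gt0 => j _; exact: betaD_gt0. Qed.

Lemma phi0 : phi 0 = 1.
Proof. by rewrite /phi big_geq// expr0 divr1. Qed.

Lemma qcoef_m k : qcoef m k = phi k.
Proof. by rewrite /qcoef big_geq// divr1. Qed.

Lemma qcoefS i k : (i < m)%N -> (beta i + k%:R) * qcoef i k = qcoef i.+1 k.
Proof.
move=> im; rewrite /qcoef big_ltn// invfM mulrCA mulVKf//.
by rewrite gt_eqF// betaD_gt0.
Qed.

Lemma phiS k : phi k.+1 = - qcoef 0 k.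
Proof.
by rewrite /phi /qcoef /phi big_nat_recr//= exprS invfM mulN1r mulNr -mulrA.
Qed.

(** This is [D phi = - w Q_1]: the factor [k + 1] produced by [D] equals [beta 0 + k], which turns
    [Q_0] into [Q_1]. *)
Lemma euler_phi : euler phi = mulX (fun k => - qcoef 1 k).
Proof.
apply/funext => -[|k]; rewrite /euler/= ?mul0r// phiS mulrN -qcoefS; last exact: ltnW.
by rewrite beta0 -natr1 addrC.
Qed.

(** Leibniz's rule on [phi * (1 / phi) = 1] gives [D (1 / phi) = - D phi / phi ^ 2], and
    [D phi = - w Q_1] turns this into [w T_1 / phi]. *)
Lemma euler_inv : euler (inv_series phi) = mulX (conv (inv_series phi) (tcoef 1)).
Proof.
have ip := conv_inv_series phi0.
rewrite -[LHS]conv1s -ip [conv phi _]convC -convA [in RHS]convC -conv_mulXl convC.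
congr conv; apply/funext => n.
have := conv_euler phi (inv_series phi) n; rewrite ip euler_phi conv_mulXl.
have -> : euler (@one_series R) n = 0.
  by case: n => [|n]; rewrite /euler /one_series ?mul0r//= mulr0.
move/esym/eqP; rewrite addrC addr_eq0 => /eqP ->.
case: n => [|n]; rewrite /= ?oppr0// /tcoef /conv -sumrN.
by apply: eq_bigr => j _; rewrite mulNr opprK.
Qed.

(** Leibniz's rule for [T_i = Q_i * (1 / phi)]: differentiating [Q_i] yields [T_(i+1)],
    differentiating [1 / phi] yields the quadratic term. *)
Lemma tcoefS i k : (i < m)%N ->
  (beta i + k%:R) * tcoef i k = tcoef i.+1 k + mulX (conv (tcoef 1) (tcoef i)) k.
Proof.
move=> im; rewrite mulrDl -[k%:R * _]/(euler (tcoef i) k) conv_euler addrA.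
congr (_ + _).
  rewrite /tcoef /conv mulr_sumr -big_split; apply: eq_bigr => j _ /=.
  by rewrite -qcoefS// /euler; ring.
rewrite euler_inv convC conv_mulXl [conv (inv_series _) _]convC -convA.
by rewrite [conv (inv_series _) _]convC.
Qed.

Lemma tcoef_m : tcoef m = one_series.
Proof.
rewrite -(conv_inv_series phi0) /tcoef; congr conv.
by apply/funext => k; exact: qcoef_m.
Qed.

(** Strong induction on [k], then descending induction on [i] from [T_m = 1]: the coefficient of
    order [k] in [w T_1 T_i] involves only coefficients of order below [k]. *)
Lemma tcoef_ge0 i k : (i <= m)%N -> 0 <= tcoef i k.
Proof.
elim/ltn_ind: k i => k IHk i im.
rewrite -(subKn im); elim: (m - i)%N (leq_subr i m) => [|j IHj] jm.
  by rewrite subn0 tcoef_m ler0n.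
have jm' : (m - j.+1 < m)%N by rewrite ltn_subrL (leq_trans _ jm).
rewrite -(pmulr_rge0 _ (betaD_gt0 (m - j.+1) k)) tcoefS// addr_ge0//.
  by rewrite -subSn// subSS IHj// ltnW.
case: k IHk {IHj} => //= k IHk; apply: sumr_ge0 => l _.
by apply: mulr_ge0; apply: IHk; rewrite ?ltnS ?leq_subr ?leq_ord// ltnW.
Qed.

Lemma conv_phi_tcoef i : conv phi (tcoef i) = qcoef i.
Proof.
by rewrite /tcoef [conv (qcoef i) _]convC convA conv_inv_series ?phi0// conv1s.
Qed.

Lemma tcoef_0 i : tcoef i 0 = (\prod_(i <= j < m) beta j)^-1.
Proof.
rewrite /tcoef /conv big_ord1 /= /inv_series /= /one_series big_ord0 subr0 mulr1.
by rewrite /qcoef phi0 div1r; congr (_^-1); apply: eq_bigr => j _; rewrite addr0.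
Qed.

(** The quadratic term contributes the square of the constant term of [T_1]. Positivity here makes
    the bound [M * r < A] of [first_zero_Psi] strict. *)
Lemma tcoef11_gt0 : 0 < tcoef 1 1.
Proof.
rewrite -(pmulr_rgt0 _ (betaD_gt0 1 1)) tcoefS// ltr_wpDl ?tcoef_ge0//=.
rewrite /conv big_ord1 /= tcoef_0 -expr2 exprn_gt0// invr_gt0.
by apply: prodr_gt0.
Qed.

End Riccati.

(** * Entire real power series and the minimum principle *)

Section RealPowerSeries.
Variable R : realType.
Implicit Types (c : nat -> R) (x : R).

(** Coefficientwise domination by [M * exp (C * w)]: a class of entire series stable under the
    operations used below. *)
Definition exp_bounded c :=
  exists M C : R, 0 <= C /\ forall n, `|c n| <= M * (C ^+ n / n`!%:R).

Definition psum c x : R := limn (pseries c x).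

Lemma exp_boundedS c : exp_bounded c -> exp_bounded (pseries_diffs c).
Proof.
move=> [M [C [C0 cM]]]; exists (M * C), C; split=> // n.
rewrite /pseries_diffs normrM ger0_norm//.
apply: le_trans (ler_wpM2l _ (cM n.+1)) _; first exact: ler0n.
rewrite factS natrM invfM exprS.
have n1 : n.+1%:R != 0 :> R by rewrite pnatr_eq0.
by rewrite mulrCA mulrA [_ * (_^-1 * _)]mulrCA -!mulrA mulVKf.
Qed.

Lemma exp_bounded_le c c' k : exp_bounded c ->
  (forall n, `|c' n| <= k * `|c n|) -> exp_bounded c'.
Proof.
move=> [M [C [C0 cM]]] cc'; exists (`|k| * M), C; split=> // n.
apply: (le_trans (cc' n)); apply: (le_trans (ler_wpM2r _ (ler_norm k))) => //.
by rewrite -mulrA ler_wpM2l.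
Qed.

Lemma exp_bounded_summable c x : exp_bounded c ->
  cvgn (series (fun n => `|c n * x ^+ n|)).
Proof.
move=> [M [C [C0 cM]]].
apply: (@series_le_cvg _ _ (M *: exp_coeff (C * `|x|))) => [n|n|n|].
- exact: normr_ge0.
- apply: (@le_trans _ _ `|c n * x ^+ n|) => //.
  rewrite normrM normrX /= scalrfctE/= /exp_coeff/= exprMn.
  by apply: le_trans (ler_wpM2r _ (cM n)) _; rewrite ?exprn_ge0// -!mulrA [_^-1 * _]mulrC.
- rewrite normrM normrX /= scalrfctE/= /exp_coeff/= exprMn.
  by apply: le_trans (ler_wpM2r _ (cM n)) _; rewrite ?exprn_ge0// -!mulrA [_^-1 * _]mulrC.
- exact/is_cvg_seriesZ/is_cvg_series_exp_coeff.
Qed.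

Lemma exp_bounded_cvg c x : exp_bounded c -> cvgn (pseries c x).
Proof.
move=> ec; apply: normed_cvg; rewrite /normed_series_of/=.
exact: exp_bounded_summable.
Qed.

Lemma is_derive_psum c x : exp_bounded c ->
  is_derive x 1 (psum c) (psum (pseries_diffs c) x).
Proof.
move=> ec; apply: (@pseries_snd_diffs _ c (`|x| + 1) x).
- exact: exp_bounded_cvg.
- exact/exp_bounded_cvg/exp_boundedS.
- exact/exp_bounded_cvg/exp_boundedS/exp_boundedS.
- by rewrite [ltRHS]ger0_norm ?addr_ge0// ltrDl.
Qed.

Lemma psumD c c' x : exp_bounded c -> exp_bounded c' ->
  psum (fun n => c n + c' n) x = psum c x + psum c' x.
Proof.
move=> ec ec'; rewrite /psum -lim_seriesD; [|exact: exp_bounded_cvg..].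
by congr (limn (series _)); apply/funext => n; rewrite addrfctE/= mulrDl.
Qed.

Lemma psumZ k c x : exp_bounded c -> psum (fun n => k * c n) x = k * psum c x.
Proof.
move=> ec; rewrite /psum -[RHS]lim_seriesZ; last exact: exp_bounded_cvg.
by congr (limn (series _)); apply/funext => n; rewrite scalrfctE/= -mulrA.
Qed.

Lemma psum_mulX c x : exp_bounded c -> psum (mulX c) x = x * psum c x.
Proof.
move=> ec; apply: cvg_lim => //; rewrite -cvg_shiftS.
have -> : [sequence pseries (mulX c) x n.+1]_n = x *: pseries c x.
  apply/funext => n; rewrite /pseries /series/= scalrfctE.
  rewrite big_nat_recl// mul0r add0r /= scaler_sumr; apply: eq_bigr => i _.
  by rewrite exprS mulrCA.
by apply: cvgZl_tmp; exact: exp_bounded_cvg.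
Qed.

Lemma exp_bounded_one : exp_bounded one_series.
Proof.
exists 1, 0; split => // -[|n]; rewrite /one_series/= ?expr0 ?fact0 ?invr1 ?mulr1 ?normr1//.
by rewrite normr0 expr0n mul0r mulr0.
Qed.

Lemma exp_bounded_mulX c : exp_bounded c -> exp_bounded (mulX c).
Proof.
move=> [M [C [C0 cM]]].
have M0 : 0 <= M.
  by have := cM 0%N; rewrite expr0 fact0 invr1 !mulr1; exact: le_trans.
(* The shift replaces [1 / n!] by [(n + 1) / (n + 1)!]; the factor [n + 1] is absorbed by
   [2 ^ (n + 1)], and [C ^ n] by [(C + 1) ^ (n + 1)]. *)
exists (M + M * (C + 1)), (2 * (C + 1)); split; first by rewrite mulr_ge0// addr_ge0.
move=> [|n] /=; first by rewrite normr0 expr0 fact0 invr1 !mulr1 !addr_ge0// mulr_ge0// addr_ge0.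
apply: (le_trans (cM n)).
have n2 : n.+1%:R <= 2 ^+ n.+1 :> R by rewrite -natrX ler_nat ltnW// ltn_expl.
have nf : 0 < n`!%:R :> R by rewrite ltr0n fact_gt0.
have -> : M * (C ^+ n / n`!%:R) = M * (C ^+ n * n.+1%:R / n.+1`!%:R).
  rewrite factS natrM invfM; congr (M * _).
  have n1 : n.+1%:R != 0 :> R by rewrite pnatr_eq0.
  by rewrite -mulrA mulVKf.
have M0' : 0 <= M * (C + 1) by rewrite mulr_ge0// addr_ge0.
apply: (@le_trans _ _ (M * ((2 * (C + 1)) ^+ n.+1 / n.+1`!%:R))); last first.
  rewrite ler_wpM2r//; last by rewrite lerDl.
  by rewrite divr_ge0// exprn_ge0// mulr_ge0// addr_ge0.
rewrite ler_wpM2l// ler_wpM2r// exprMn mulrC ler_pM// ?exprn_ge0//.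
apply: (@le_trans _ _ ((C + 1) ^+ n)).
  by rewrite lerXn2r// ?nnegrE ?addr_ge0// lerDl.
by rewrite exprS ler_peMl ?exprn_ge0 ?addr_ge0// lerDr.
Qed.

Lemma mulX_pseries_diffs c : mulX (pseries_diffs c) = euler c.
Proof. by apply/funext => -[|n]//; rewrite /euler mul0r. Qed.

Lemma exp_bounded_euler c : exp_bounded c -> exp_bounded (euler c).
Proof.
by move=> ec; rewrite -mulX_pseries_diffs; exact/exp_bounded_mulX/exp_boundedS.
Qed.

Lemma exp_boundedZ k c : exp_bounded c -> exp_bounded (fun n => k * c n).
Proof. by move=> /(@exp_bounded_le _ _ `|k|); apply=> n; rewrite normrM. Qed.

Lemma exp_boundedD c c' : exp_bounded c -> exp_bounded c' ->
  exp_bounded (fun n => c n + c' n).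
Proof.
move=> [M [C [C0 cM]]] [M' [C' [C'0 cM']]].
have M0 : 0 <= M by have := cM 0%N; rewrite expr0 fact0 invr1 !mulr1; exact: le_trans.
have M'0 : 0 <= M' by have := cM' 0%N; rewrite expr0 fact0 invr1 !mulr1; exact: le_trans.
exists (M + M'), (C + C'); split; first exact: addr_ge0.
move=> n; apply: (le_trans (ler_normD _ _)); rewrite mulrDl lerD//.
  apply: (le_trans (cM n)); rewrite ler_wpM2l// ler_wpM2r//.
  by rewrite lerXn2r// ?nnegrE ?addr_ge0// lerDl.
apply: (le_trans (cM' n)); rewrite ler_wpM2l// ler_wpM2r//.
by rewrite lerXn2r// ?nnegrE ?addr_ge0// lerDr.
Qed.

Lemma psum_euler c x : exp_bounded c -> psum (euler c) x = x * psum (pseries_diffs c) x.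
Proof.
by move=> ec; rewrite -psum_mulX ?mulX_pseries_diffs//; exact: exp_boundedS.
Qed.

Lemma psum0 c : psum c 0 = c 0.
Proof.
apply: cvg_lim => //; rewrite -cvg_shiftS.
have -> : [sequence pseries c 0 n.+1]_n = cst (c 0).
  apply/funext => n; rewrite /pseries /series/=.
  by rewrite big_nat_recl// expr0 mulr1 big1 ?addr0// => i _; rewrite expr0n mulr0.
exact: cvg_cst.
Qed.

Lemma continuous_psum c : exp_bounded c -> continuous (psum c).
Proof.
move=> ec x; apply/differentiable_continuous/derivable1_diffP.
by have [] := is_derive_psum x ec.
Qed.

(* At a negative minimum [c] of [f], [c * f' c] is nonpositive. *)
Lemma ge0_of_euler_ge0 (f f' : R -> R) (b X : R) : 0 < b ->
  (forall x, is_derive x 1 f (f' x)) ->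
  (forall x, 0 <= x <= X -> 0 <= x * f' x + b * f x) ->
  forall x, 0 <= x <= X -> 0 <= f x.
Proof.
move=> b0 df ineq x /andP[x0 xX].
have fd y : derivable f y 1 by have [] := df y.
have [|c] := @EVT_min _ f 0 x x0.
  by apply: derivable_within_continuous => y _; exact: fd.
rewrite in_itv/= => /andP[c0 cx] cmin.
apply: (@le_trans _ _ (f c)); last by apply: cmin; rewrite in_itv/= x0 lexx.
rewrite leNgt; apply/negP => fc.
suff f'c : c * f' c <= 0.
  have := ineq c; rewrite c0 (le_trans cx xX) => /(_ isT).
  by rewrite leNgt => /negP; apply; rewrite -(addr0 0) ler_ltD// pmulr_rlt0.
move: c0; rewrite le_eqVlt => /predU1P[<-|c0]; first by rewrite mul0r.
apply: mulr_ge0_le0; first exact: ltW.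
rewrite -(@derive_val _ _ _ _ _ _ _ (df c)).
(* The minimum may sit at the right endpoint of [[0, x]], so the sign of the derivative is read off
   the left difference quotients. *)
rewrite ['D_1 f c]cvg_at_leftE; last exact: fd.
apply: limr_le.
  rewrite -(cvg_at_leftE (fun h => h^-1 *: ((f \o shift c) _ - f c))) //; last exact: fd.
  have := fd c; apply: cvg_trans; apply: cvg_app.
  move=> A [e egt0 Ae]; exists e => // y xe xgt0; apply: Ae => //.
  exact/ltr0_neq0.
near=> h; apply: mulr_le0_ge0.
  by rewrite invr_le0; apply: ltW; near: h; exists 1 => /=.
rewrite subr_ge0 [_%:A]mulr1; apply: cmin; near: h.
exists c => //= h; rewrite /= distrC subr0 => hc h0.
rewrite in_itv/=; apply/andP; split.
  by move: hc; rewrite ltr0_norm// => hc; lra.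
by lra.
Unshelve. all: by end_near. Qed.

End RealPowerSeries.

(** * Partial sums of the Riccati solution *)

Section NonnegPoly.
Variable R : realFieldType.

Lemma ler_horner (p q : {poly R}) x : 0 <= x -> (forall k, p`_k <= q`_k) ->
  p.[x] <= q.[x].
Proof.
move=> x0 pq; rewrite -subr_ge0 -hornerN -hornerD horner_coef sumr_ge0// => k _.
by rewrite mulr_ge0 ?exprn_ge0// coefD coefN subr_ge0.
Qed.

(** The product of the truncations contains every term of the truncated product, and its further
    terms are nonnegative. *)
Lemma ler_horner_conv (a b : nat -> R) N N' x : 0 <= x -> (N <= N')%N ->
  (forall k, 0 <= a k) -> (forall k, 0 <= b k) ->
  (\poly_(k < N) conv a b k).[x] <= (\poly_(k < N) a k).[x] * (\poly_(k < N') b k).[x].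
Proof.
move=> x0 NN' a0 b0; rewrite -hornerM; apply: ler_horner => // k.
rewrite coef_poly; case: ltnP => kN.
  by rewrite -conv_coefM// (leq_trans kN).
by rewrite coefM sumr_ge0// => j _; rewrite mulr_ge0// coef_poly; case: ifP.
Qed.

Lemma mulX_deriv_poly (a : nat -> R) N b :
  'X * (\poly_(k < N) a k)^`() + b *: \poly_(k < N) a k =
  \poly_(k < N) ((b + k%:R) * a k).
Proof.
apply/polyP => k; rewrite coefD coefZ coefXM coef_deriv !coef_poly.
case: k => [|k] /=; first by case: ifP; rewrite ?addr0 ?mulr0 ?addr0// add0r.
by case: ifP; rewrite ?mul0rn ?mulr0 ?addr0// mulrDl addrC mulr_natl.
Qed.

Lemma poly_mulX (a : nat -> R) N :
  \poly_(k < N.+1) mulX a k = 'X * \poly_(k < N) a k.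
Proof.
apply/polyP => -[|k]; rewrite coefXM !coef_poly//=; by rewrite ltnS.
Qed.

End NonnegPoly.

Section Comparison.
Variables (R : realType) (m : nat) (beta : nat -> R).
Hypotheses (m_gt1 : (1 < m)%N) (beta0 : beta 0 = 1) (beta_gt0 : forall i, 0 < beta i).
Local Notation phi := (phi m beta).
Local Notation q := (qcoef m beta).
Local Notation t := (tcoef m beta).

(** Passing from [k] to [k + 1] divides the modulus by [(k + 1)] times the product of the
    [beta i + k], [i >= 1], which is at least [D]. *)
Lemma exp_bounded_phi : exp_bounded phi.
Proof.
pose D := \prod_(1 <= i < m) beta i.
have D0 : 0 < D by exact: prodr_gt0.
exists 1, D^-1; split; first by rewrite invr_ge0 ltW.
elim=> [|k IHk]; first by rewrite phi0 normr1 expr0 fact0 invr1 !mulr1.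
rewrite phiS normrN normrM normfV [in X in _ / X]gtr0_norm; last exact: prod_betaD_gt0.
rewrite mul1r exprSr factS natrM [(_%:R * _)^-1]invfM [(_^-1 * _^-1)]mulrC mulrACA.
rewrite mul1r in IHk; apply: ler_pM => //; first by rewrite invr_ge0 ltW// prod_betaD_gt0.
rewrite -invfM lef_pV2 ?posrE ?prod_betaD_gt0 ?mulr_gt0// [leRHS]big_ltn; last exact: ltnW.
rewrite beta0 nat1r mulrC ler_wpM2l// /D; apply: ler_prod => j _.
by rewrite ltW//= lerDl.
Qed.

Lemma exp_bounded_qcoef i : exp_bounded (q i).
Proof.
apply: (@exp_bounded_le _ _ _ (\prod_(i <= j < m) beta j)^-1 exp_bounded_phi) => k.
rewrite normrM normfV [in X in _ / X]gtr0_norm ?prod_betaD_gt0// mulrC ler_wpM2r//.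
rewrite lef_pV2 ?posrE ?prod_betaD_gt0//; last exact: prodr_gt0.
by apply: ler_prod => j _; rewrite ltW//= lerDl.
Qed.

Local Notation Phi := (psum phi).
Local Notation Q i := (psum (q i)).

Lemma psum_qcoefS i x : (i < m)%N ->
  x * psum (pseries_diffs (q i)) x + beta i * Q i x = Q i.+1 x.
Proof.
move=> im; have eq_i := exp_bounded_qcoef i.
rewrite -psum_euler// -psumZ// -psumD//.
- by congr (psum _ x); apply/funext => k; rewrite -qcoefS// /euler mulrDl addrC.
- exact: exp_bounded_euler.
- exact: exp_boundedZ.
Qed.

Lemma pseries_diffs_phi : pseries_diffs phi = fun k => (-1) * q 1 k.
Proof.
apply/funext => k; have /(congr1 (@^~ k.+1)) := euler_phi m_gt1 beta0 beta_gt0.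
by rewrite mulN1r.
Qed.

Lemma is_derive_phi (x : R) : is_derive x (1 : R) Phi (- Q 1 x).
Proof.
have := is_derive_psum x exp_bounded_phi; rewrite pseries_diffs_phi psumZ ?mulN1r//.
exact: exp_bounded_qcoef.
Qed.

Lemma qcoef_mE : q m = phi.
Proof. by apply/funext => k; exact: qcoef_m. Qed.

Variable X : R.
Hypothesis Phi_ge0 : forall x : R, 0 <= x <= X -> 0 <= Phi x.

(** Descending induction from [Q_m = Phi], by the minimum principle applied to
    [(D + beta_i) Q_i = Q_(i+1)]. *)
Lemma psum_qcoef_ge0 i (x : R) : (i <= m)%N -> 0 <= x <= X -> 0 <= Q i x.
Proof.
move=> im; rewrite -(subKn im); elim: (m - i)%N (leq_subr i m) x => [|j IHj] jm x.
  by rewrite subn0 qcoef_mE; exact: Phi_ge0.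
have jm' : (m - j.+1 < m)%N by rewrite ltn_subrL (leq_trans _ jm).
apply: (@ge0_of_euler_ge0 _ _ (psum (pseries_diffs (q (m - j.+1)))) (beta (m - j.+1))) => //.
  by move=> y; apply: is_derive_psum; exact: exp_bounded_qcoef.
move=> y yX; rewrite psum_qcoefS// -subSn// subSS.
by apply: IHj => //; exact: ltnW.
Qed.

(** Induction on the truncation order, then descending induction on the index [l]. With [P] the
    truncation of [T_l], applying [D + beta_l] to [Q_l - P Phi] gives
    [(Q_(l+1) - P1 Phi) + w (P Q_1 - C Phi)]. The inner hypothesis handles the first term, the outer
    one for [T_1] the second, and the minimum principle concludes. *)
Lemma tcoef_le_qcoef N i (x : R) : (i <= m)%N -> 0 <= x <= X ->
  (\poly_(k < N) t i k).[x] * Phi x <= Q i x.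
Proof.
have tge0 j k : (j <= m)%N -> 0 <= t j k by exact: tcoef_ge0.
have qE := exp_bounded_qcoef.
elim: N i x => [|N IHN] i x im.
  move=> xX; rewrite (_ : poly _ _ = 0) ?horner0 ?mul0r ?psum_qcoef_ge0//.
  by apply/polyP => k; rewrite coef_poly coef0.
rewrite -(subKn im); elim: (m - i)%N (leq_subr i m) x => [|j IHj] jm x xX.
  rewrite subn0 qcoef_mE tcoef_m// horner_poly big_ord_recl/= mul1r big1 ?addr0 ?mul1r//.
  by move=> k _; rewrite mul0r.
have jm' : (m - j.+1 < m)%N by rewrite ltn_subrL (leq_trans _ jm).
move: IHj; rewrite -subSS subSn//; move: (m - j.+1)%N jm' => l lm /(_ (ltnW jm)) IHj.
set P := \poly_(k < N.+1) t l k.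
rewrite -subr_ge0.
apply: (@ge0_of_euler_ge0 _ (fun y => Q l y - P.[y] * Phi y)
  (fun y => psum (pseries_diffs (q l)) y - (P^`().[y] * Phi y - P.[y] * Q 1 y))
  (beta l) X (beta_gt0 l) _ _ _ xX) => {x xX} x.
  have dQ : is_derive x (1 : R) (Q l) (psum (pseries_diffs (q l)) x) by exact: is_derive_psum.
  have dPhi := is_derive_phi x.
  apply: is_derive_eq.
  by rewrite /GRing.scale/=; ring.
move=> xX; have /andP[x0 _] := xX.
have Phi0 := Phi_ge0 xX.
pose P1 := \poly_(k < N.+1) t l.+1 k.
(* The factor [w] shifts the index, so order [N.+1] uses only [N] terms of the convolution, within
   reach of the hypothesis at [N]. *)
pose C := \poly_(k < N) conv (t 1) (t l) k.
have PE : x * P^`().[x] + beta l * P.[x] = P1.[x] + x * C.[x].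
  have : 'X * P^`() + beta l *: P = P1 + 'X * C.
    rewrite mulX_deriv_poly -poly_mulX; apply/polyP => k.
    by rewrite coefD !coef_poly; case: ifP; rewrite ?addr0// tcoefS.
  by move/(congr1 (horner^~ x)); rewrite !hornerE.
rewrite [leRHS](_ : _ = (Q l.+1 x - P1.[x] * Phi x) + x * (P.[x] * Q 1 x - C.[x] * Phi x)); last first.
  rewrite -(psum_qcoefS x lm).
  transitivity (x * psum (pseries_diffs (q l)) x + beta l * Q l x
    - (x * P^`().[x] + beta l * P.[x]) * Phi x + x * P.[x] * Q 1 x); first by ring.
  by rewrite PE; ring.
apply: addr_ge0; first by rewrite subr_ge0; exact: IHj.
rewrite mulr_ge0// subr_ge0.
apply: (@le_trans _ _ (P.[x] * ((\poly_(k < N) t 1 k).[x] * Phi x))); last first.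
  rewrite ler_wpM2l//; last by apply: IHN => //; exact: ltnW.
  rewrite horner_poly sumr_ge0// => k _; rewrite mulr_ge0 ?exprn_ge0//.
  by apply: tge0; exact: ltnW.
rewrite mulrA ler_wpM2r// mulrC.
by apply: ler_horner_conv => // k; apply: tge0; exact: ltnW.
Qed.

End Comparison.

(** * Alternating series and the first zero of psi *)

Section AlternatingSeries.
Variable R : realType.
Implicit Type b : nat -> R.

Lemma alternating_sum_bounds b n : (forall k, 0 <= b k) -> (forall k, b k.+1 <= b k) ->
  0 <= \sum_(i < n) (-1) ^+ i * b i <= b 0.
Proof.
elim: n b => [|n IHn] b b0 bS; first by rewrite big_ord0 lexx b0.
rewrite big_ord_recl expr0 mul1r.
rewrite [X in _ + X](_ : _ = - \sum_(i < n) (-1) ^+ i * b i.+1); last first.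
  by rewrite -sumrN; apply: eq_bigr => i _; rewrite /= /bump add1n exprS mulN1r mulNr.
have /andP[s0 s1] := IHn (fun i => b i.+1) (fun i => b0 i.+1) (fun i => bS i.+1).
by rewrite subr_ge0 (le_trans s1 (bS _))/= gerBl.
Qed.

(** Up to the sign [(-1) ^ N], the tail is an alternating sum of decreasing terms. Monotonicity is
    asked only from [N] on because the first two terms of [Psi] may increase. *)
Lemma alternating_series_bound b (L : R) N :
  series (fun k => (-1) ^+ k * b k) @ \oo --> L ->
  (forall k, (N <= k)%N -> 0 <= b k) -> (forall k, (N <= k)%N -> b k.+1 <= b k) ->
  0 <= (-1) ^+ N * (L - \sum_(i < N) (-1) ^+ i * b i).
Proof.
move=> bL b0 bS; set u := series _ in bL.
have uE n : (N <= n)%N -> 0 <= (-1) ^+ N * (u n - \sum_(i < N) (-1) ^+ i * b i).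
  move=> Nn; rewrite /u /series/= (big_cat_nat (leq0n N) Nn) big_mkord addrC addKr.
  rewrite -[X in \sum_(X <= _ < _) _]add0n big_addn big_mkord mulr_sumr.
  have /andP[] := @alternating_sum_bounds (fun i => b (i + N)%N) (n - N)
    (fun i => b0 _ (leq_addl _ _)) (fun i => bS _ (leq_addl _ _)).
  move=> + _; congr (0 <= _); apply: eq_bigr => i _.
  by rewrite mulrA -exprD addnCA addnn exprD -mul2n exprM sqrrN !expr1n mulr1.
have cv : (fun n => (-1) ^+ N * (u n - \sum_(i < N) (-1) ^+ i * b i)) @ \oo -->
    (-1) ^+ N * (L - \sum_(i < N) (-1) ^+ i * b i).
  by apply: cvgMr; apply: cvgB => //; exact: cvg_cst.
rewrite -(cvg_lim _ cv)//; apply: limr_ge; first by apply/cvg_ex; eexists; exact: cv.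
by exists N => // n /= Nn; exact: uE.
Qed.

(** The zero is the infimum of the points of [[0, +oo[] where [f <= 0]: continuity gives [f <= 0]
    there, and the intermediate value theorem finds a zero no further right. *)
Lemma first_zero (f : R -> R) X : continuous f -> 0 <= X -> 0 < f 0 -> f X < 0 ->
  exists r, [/\ 0 < r < X, f r = 0 & forall x, 0 <= x < r -> 0 < f x].
Proof.
move=> fc X0 f0 fX; pose S := [set x : R | 0 <= x /\ f x <= 0].
have SX : S X by split => //; exact: ltW.
have Slb : lbound S 0 by move=> y [].
have hS : has_inf S by split; [exists X|exists 0].
set r := inf S.
have r0 : 0 <= r by apply: lb_le_inf => //; exists X.
have rX : r <= X by apply: ge_inf => //; exists 0.
have flt x : 0 <= x < r -> 0 < f x.
  move=> /andP[x0 xr]; rewrite ltNge; apply/negP => fx.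
  by move: xr; rewrite ltNge ge_inf//; exists 0.
have fr : f r <= 0.
  rewrite leNgt; apply/negP => fr0.
  have /nbhs_ballP[e /= e0 fe] : \forall y \near r, 0 < f y.
    exact: (cvgr_gt (f r) (fc r)).
  have [y [y0 fy] yr] := inf_adherent e0 hS.
  have : 0 < f y.
    apply: fe; rewrite /ball/= ltr_distlC.
    rewrite yr andbT (@lt_le_trans _ _ r)//; first by rewrite ltrBlDr ltrDl.
    by apply: ge_inf => //; exists 0.
  by rewrite ltNge fy.
have [|c] := @IVT _ f 0 r 0 r0 (continuous_subspaceT fc).
  by rewrite ge_min fr orbT le_max (ltW f0).
rewrite in_itv/= => /andP[c0 cr] fc0.
have rc : r = c.
  by apply/eqP; rewrite eq_le cr andbT ge_inf//; [exists 0|split; rewrite ?fc0].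
exists r; split => //; last by rewrite rc.
rewrite !lt_neqAle r0 rX !andbT; apply/andP; split.
  by apply/eqP => r0'; move: fr; rewrite -r0' leNgt f0.
by apply/eqP => rX'; move: fX; rewrite -rX' rc fc0 ltxx.
Qed.

End AlternatingSeries.

Section FirstCriticalPoint.
Variables (R : realType) (m : nat) (beta : nat -> R).
Hypotheses (m_gt1 : (1 < m)%N) (beta0 : beta 0 = 1) (beta_gt0 : forall i, 0 < beta i).
Local Notation phi := (phi m beta).
Local Notation q := (qcoef m beta).
Local Notation t := (tcoef m beta).
Local Notation Phi := (psum phi).
Local Notation Q i := (psum (q i)).

Definition psi k : R := (1 + m%:R * k%:R) * phi k.
Local Notation Psi := (psum psi).

Lemma exp_bounded_psi : exp_bounded psi.
Proof.
have -> : psi = fun k => phi k + m%:R * euler phi k.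
  by apply/funext => k; rewrite /psi /euler mulrDl mul1r mulrA.
apply: exp_boundedD; first exact: exp_bounded_phi.
exact/exp_boundedZ/exp_bounded_euler/exp_bounded_phi.
Qed.

Lemma psum_psi x : Psi x = Phi x - m%:R * (x * Q 1 x).
Proof.
have ephi := exp_bounded_phi m_gt1 beta0 beta_gt0.
have -> : psi = fun k => phi k + m%:R * euler phi k.
  by apply/funext => k; rewrite /psi /euler mulrDl mul1r mulrA.
rewrite psumD//; last exact/exp_boundedZ/exp_bounded_euler.
rewrite psumZ ?psum_euler//; last exact/exp_bounded_euler.
rewrite pseries_diffs_phi// psumZ; last exact: exp_bounded_qcoef.
by rewrite mulN1r !mulrN.
Qed.

(** Since [(D + 1 / m) Phi = Psi / m], the minimum principle gives [Phi >= 0], hence [Q_1 >= 0], and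
    then [Phi = Psi + m x Q_1] is positive. *)
Lemma Phi_gt0 X : (forall x, 0 <= x <= X -> 0 < Psi x) ->
  forall x, 0 <= x <= X -> 0 < Phi x /\ m%:R * (x * Q 1 x) < Phi x.
Proof.
move=> Psi0; have m0 : 0 < m%:R :> R by rewrite ltr0n ltnW.
have Phi0 x : 0 <= x <= X -> 0 <= Phi x.
  apply: (@ge0_of_euler_ge0 _ _ (fun y => - Q 1 y) m%:R^-1 X) => [|y|y yX].
  - by rewrite invr_gt0.
  - exact: is_derive_phi.
  - have -> : y * - Q 1 y + m%:R^-1 * Phi y = m%:R^-1 * Psi y.
      by rewrite psum_psi; field; rewrite gt_eqF.
    by rewrite mulr_ge0 ?invr_ge0// ?ltW// Psi0.
move=> x xX; have /andP[x0 _] := xX.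
have := Psi0 x xX; rewrite psum_psi subr_gt0 => h; split=> //.
apply: le_lt_trans h; rewrite !mulr_ge0// ?(ltW m0)//.
by apply: (psum_qcoef_ge0 m_gt1 beta0 beta_gt0 Phi0) => //; exact: ltnW.
Qed.

End FirstCriticalPoint.

(** * Coefficients of psi and signs of its truncation errors *)

Section RayleighBounds.
Variables (R : realType) (m : nat) (beta : nat -> R).
Hypotheses (m_gt1 : (1 < m)%N) (beta0 : beta 0 = 1) (beta_gt0 : forall i, 0 < beta i).
Local Notation phi := (phi m beta).
Local Notation q := (qcoef m beta).
Local Notation t := (tcoef m beta).
Local Notation Phi := (psum phi).
Local Notation Q i := (psum (q i)).
Local Notation psi := (psi m beta).
Local Notation Psi := (psum psi).

Definition abs_psi k : R :=
  (1 + m%:R * k%:R) / \prod_(0 <= j < k) \prod_(0 <= i < m) (beta i + j%:R).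
Local Notation c := abs_psi.
Local Notation A := (\prod_(1 <= i < m) beta i).
Local Notation B := (\prod_(1 <= i < m) (beta i + 1)).
Local Notation M := (m%:R : R).

Lemma psiE k : psi k = (-1) ^+ k * c k.
Proof. by rewrite /psi /abs_psi /phi mulrCA. Qed.

Lemma abs_psi_gt0 k : 0 < c k.
Proof.
apply: divr_gt0; first by rewrite ltr_pwDl// mulr_ge0.
by apply: prodr_gt0 => j _; exact: prod_betaD_gt0.
Qed.

Lemma prod_beta_gt0 : 0 < A.
Proof. exact: prodr_gt0. Qed.

Lemma prod_beta_lt : A < B.
Proof.
rewrite (big_ltn m_gt1) [ltRHS]big_ltn// (@le_lt_trans _ _ (beta 1 * \prod_(2 <= i < m) (beta i + 1)))//.
  by rewrite ler_wpM2l ?(ltW (beta_gt0 1))//; apply: ler_prod => i _; rewrite ltW//= lerDl.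
by rewrite ltr_pM2r ?ltrDl//; apply: prodr_gt0 => i _; rewrite addr_gt0.
Qed.

Lemma abs_psiS k : c k.+1 * ((1 + k%:R) * \prod_(1 <= i < m) (beta i + k%:R)) *
  (1 + M * k%:R) = c k * (1 + M * k.+1%:R).
Proof.
rewrite /abs_psi big_nat_recr//= [X in _ / (_ * X)]big_ltn ?(ltnW m_gt1)// beta0.
have := prod_betaD_gt0 m beta_gt0 1 k; set G := \prod_(1 <= i < m) _ => G0.
have : 0 < \prod_(0 <= j < k) \prod_(0 <= i < m) (beta i + j%:R).
  by apply: prodr_gt0 => j _; exact: prod_betaD_gt0.
set H := \prod_(0 <= j < k) _ => H0.
have k0 : 0 < 1 + k%:R :> R by rewrite ltr_pwDl.
field; rewrite (gt_eqF G0) (gt_eqF H0) /=; apply/eqP => h.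
by move: k0; rewrite h ltxx.
Qed.

(** In the ratio given by [abs_psiS], the product of the [beta i + k] is at least [B] for [k >= 1],
    and [1 + M (k + 1) <= (1 + M k) (k + 1)]. Hence the terms [c k * x ^ k] decrease from [k = 1] on
    when [0 <= x <= B]. *)
Lemma abs_psi_decr k : (0 < k)%N -> c k.+1 * B <= c k.
Proof.
move=> k0; have Mk : 0 < (1 + M * k%:R) * k.+1%:R.
  by rewrite mulr_gt0 ?ltr0Sn// ltr_pwDl// mulr_ge0.
rewrite -(ler_pM2r Mk); apply: (@le_trans _ _ (c k * (1 + M * k.+1%:R))).
  rewrite -abs_psiS; set G := \prod_(1 <= i < m) (_ + k%:R).
  have BG : B <= G.
    apply: ler_prod => i _; rewrite addr_ge0 ?(ltW (beta_gt0 _))//=.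
    by rewrite lerD2l ler1n.
  have -> : c k.+1 * B * ((1 + M * k%:R) * k.+1%:R) = c k.+1 * ((1 + M * k%:R) * k.+1%:R) * B.
    by rewrite mulrAC.
  have -> : c k.+1 * ((1 + k%:R) * G) * (1 + M * k%:R) = c k.+1 * ((1 + M * k%:R) * k.+1%:R) * G.
    by rewrite -nat1r; ring.
  by rewrite ler_wpM2l// mulr_ge0 ?(ltW Mk)// ltW// abs_psi_gt0.
rewrite ler_wpM2l ?(ltW (abs_psi_gt0 _))//.
have mk : (m <= m * (k * k))%N by rewrite leq_pmulr// muln_gt0 k0.
rewrite -!natrM !nat1r -natrM ler_nat.
nia.
Qed.

Lemma Psi_alternating N (x : R) : (0 < N)%N -> 0 <= x <= B ->
  0 <= (-1) ^+ N * (Psi x - \sum_(i < N) (-1) ^+ i * (c i * x ^+ i)).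
Proof.
move=> N0 /andP[x0 xB]; apply: (@alternating_series_bound _ (fun i => c i * x ^+ i)).
- have := exp_bounded_cvg (x := x) (exp_bounded_psi m_gt1 beta0 beta_gt0).
  suff -> : series (fun k => (-1) ^+ k * (c k * x ^+ k)) = pseries psi x by [].
  by congr series; apply/funext => k; rewrite /= psiE mulrA.
- by move=> k _; rewrite mulr_ge0 ?exprn_ge0// ltW// abs_psi_gt0.
- move=> k Nk; rewrite exprS mulrA ler_wpM2r ?exprn_ge0//.
  apply: (le_trans _ (abs_psi_decr (leq_trans N0 Nk))).
  by rewrite ler_wpM2l// ltW// abs_psi_gt0.
Qed.

Lemma abs_psi0 : c 0 = 1.
Proof. by rewrite /abs_psi big_geq// mulr0 addr0 divr1. Qed.

Lemma abs_psi1 : c 1 = (M + 1) / A.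
Proof.
have A0 := prod_beta_gt0.
have := abs_psiS 0; rewrite abs_psi0 mulr0 !addr0 !mulr1 !mul1r.
under eq_bigr do rewrite addr0.
by move=> h; apply: (mulIf (lt0r_neq0 A0)); rewrite h mulfVK ?gt_eqF// addrC.
Qed.

Lemma abs_psi2 : c 2 = (2 * M + 1) / (2 * A * B).
Proof.
have A0 := prod_beta_gt0; have B0 := lt_trans A0 prod_beta_lt.
have M0 : 0 <= M by [].
have := abs_psiS 1; rewrite abs_psi1 mulr1.
set B' := \prod_(_ <= i < _) _ => h.
have h1 : 2 * B' * (1 + M) != 0 by rewrite gt_eqF// !mulr_gt0// ltr_pwDl.
apply: (mulIf h1); rewrite mulrA.
have -> : 2 = 1 + 1 :> R by [].
rewrite {1}/B' h; field.
by rewrite (gt_eqF A0) (gt_eqF B0).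
Qed.

End RayleighBounds.

(** This serves the case [m = 2], [a = beta 1]: the coefficients are those of [psi] up to order
    four, and [x] is the upper bound [X] introduced below. *)
Lemma quartic_truncation_lt0 (R : realFieldType) (a x : R) : 0 < a ->
  x = 3 * a * (a + 1) / (4 * a + 9) ->
  1 - 3 / a * x + 5 / (2 * a * (a + 1)) * x ^+ 2
    - 7 / (6 * a * (a + 1) * (a + 2)) * x ^+ 3
    + 9 / (24 * a * (a + 1) * (a + 2) * (a + 3)) * x ^+ 4 < 0.
Proof.
move=> a0 ->; have an n : 0 < a ^+ n by rewrite exprn_gt0.
(* Substituting [x] leaves [- a * P] over a positive denominator, and every coefficient of [P] is
   positive. *)
set P := 445 * a ^+ 5 + 49 * 131 * a ^+ 4 + 33 * 1039 * a ^+ 3 +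
  81 * 1217 * a ^+ 2 + 81 * 1824 * a + 81 * 1080.
have P0 : 0 < P.
  by have := (an 2, an 3, an 4, an 5)%N => -[[[h2 h3] h4] h5]; rewrite /P; lra.
rewrite [ltLHS](_ : _ = - (a * P / (8 * (a + 2) * (a + 3) * (4 * a + 9) ^+ 4))).
  have [a2 a3 a9] : [/\ 0 < a + 2, 0 < a + 3 & 0 < 4 * a + 9] by split; lra.
  rewrite oppr_lt0; apply: divr_gt0; first by rewrite mulr_gt0.
  by rewrite mulr_gt0 ?exprn_gt0// mulr_gt0// mulr_gt0.
move: P0 => _; rewrite /P; field.
by rewrite !gt_eqF//; lra.
Qed.

(** * Euler-Rayleigh bounds for the first zero of psi *)

Section FirstZero.
Variables (R : realType) (m : nat) (beta : nat -> R).
Hypotheses (m_gt1 : (1 < m)%N) (beta0 : beta 0 = 1) (beta_gt0 : forall i, 0 < beta i).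
Local Notation phi := (phi m beta).
Local Notation q := (qcoef m beta).
Local Notation t := (tcoef m beta).
Local Notation Phi := (psum phi).
Local Notation Q i := (psum (q i)).
Local Notation psi := (psi m beta).
Local Notation Psi := (psum psi).
Local Notation c := (abs_psi m beta).
Local Notation A := (\prod_(1 <= i < m) beta i).
Local Notation B := (\prod_(1 <= i < m) (beta i + 1)).
Local Notation M := (m%:R : R).
Local Notation D := ((M + 1) ^+ 2 * B - (2 * M + 1) * A).
(** This equals [c 1 / (c 1 ^ 2 - 2 * c 2)], the Euler-Rayleigh quotient of the first two power sums
    of reciprocal zeros, written through the coefficients. *)
Local Notation X := ((M + 1) * A * B / D).

Lemma Rayleigh_den_gt0 : 0 < D.
Proof.
have A0 := prod_beta_gt0 m beta_gt0; have AB := prod_beta_lt m_gt1 beta_gt0.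
have M2 : 2 <= M by rewrite ler_nat.
have : 0 < M ^+ 2 * A by rewrite mulr_gt0// exprn_gt0//; lra.
have : 0 < (M + 1) ^+ 2 * (B - A) by rewrite mulr_gt0 ?subr_gt0// exprn_gt0//; lra.
by move=> h1 h2; have := addr_gt0 h1 h2; congr (0 < _); ring.
Qed.

(** The bound by [B] brings [X] into the range of [Psi_alternating]. It amounts to [(M + 1) A <= D],
    where [D - (M + 1) A = (M + 1)^2 (B - A) + (M^2 - M - 1) A]. *)
Lemma Rayleigh_ratio_bounds : 0 < X <= B.
Proof.
have A0 := prod_beta_gt0 m beta_gt0; have AB := prod_beta_lt m_gt1 beta_gt0.
have B0 := lt_trans A0 AB; have D0 := Rayleigh_den_gt0.
have M2 : 2 <= M by rewrite ler_nat.
apply/andP; split; first by rewrite divr_gt0// !mulr_gt0//; lra.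
rewrite ler_pdivrMr// mulrC ler_wpM2l ?(ltW B0)// -subr_ge0.
have h1 : 0 <= (M + 1) ^+ 2 * (B - A) by rewrite mulr_ge0 ?exprn_ge0 ?subr_ge0 ?addr_ge0// ltW.
have h2 : 0 <= (M * (M - 2) + M - 1) * A.
  by rewrite mulr_ge0 ?(ltW A0)//; nra.
have := addr_ge0 h1 h2; congr (0 <= _); ring.
Qed.

(** The truncation at order two bounds [Psi] from above. Its value at [X] is negative because
    [(M + 1)^2 >= 2 (2 M + 1)] for [M >= 3]. *)
Lemma Psi_lt0_of_Rayleigh_ge3 : (2 < m)%N -> Psi X < 0.
Proof.
move=> m3.
have A0 := prod_beta_gt0 m beta_gt0; have AB := prod_beta_lt m_gt1 beta_gt0.
have B0 := lt_trans A0 AB; have D0 := Rayleigh_den_gt0.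
have M3 : 3 <= M by rewrite ler_nat.
have /andP[X0 XB] := Rayleigh_ratio_bounds.
have := @Psi_alternating _ _ _ m_gt1 beta0 beta_gt0 3 X isT.
rewrite (ltW X0) XB => /(_ isT).
rewrite !big_ord_recr big_ord0/= abs_psi0 abs_psi1// abs_psi2//.
set Y := Psi X => h.
have neg : 1 - (M + 1) / A * X + (2 * M + 1) / (2 * A * B) * X ^+ 2 < 0.
  have -> : 1 - (M + 1) / A * X + (2 * M + 1) / (2 * A * B) * X ^+ 2 =
    - ((2 * M + 1) * A * ((M + 1) ^+ 2 * B - 2 * (2 * M + 1) * A) / (2 * D ^+ 2)).
    by field; rewrite (gt_eqF A0) (gt_eqF B0) (gt_eqF D0).
  rewrite oppr_lt0; apply: divr_gt0; last by rewrite mulr_gt0// exprn_gt0.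
  apply: mulr_gt0; first by rewrite mulr_gt0//; lra.
  have h1 : 0 < (M + 1) ^+ 2 * (B - A) by rewrite mulr_gt0 ?subr_gt0// exprn_gt0//; lra.
  have h2 : 0 <= (M * (M - 3) + (M - 1)) * A.
    by rewrite mulr_ge0 ?(ltW A0)// addr_ge0 ?mulr_ge0//; lra.
  have := ltr_wpDr h2 h1; congr (0 < _); ring.
apply: le_lt_trans neg; rewrite -subr_ge0; move: h; congr (0 <= _); ring.
Qed.

(* When [m = 2] and [beta 1] is large, the truncation of [Psi] at order two is
   positive at [X]; order four is needed. *)
Lemma Psi_lt0_of_Rayleigh_2 : m = 2%N -> Psi X < 0.
Proof.
move=> m2.
have /andP[X0 XB] := Rayleigh_ratio_bounds.
have := @Psi_alternating _ _ _ m_gt1 beta0 beta_gt0 5 X isT.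
rewrite (ltW X0) XB => /(_ isT).
have c3 := abs_psiS m_gt1 beta0 beta_gt0 2; have c4 := abs_psiS m_gt1 beta0 beta_gt0 3.
rewrite !big_ord_recr big_ord0/= abs_psi0 abs_psi1// abs_psi2//.
move: c3; rewrite abs_psi2//.
set Y := Psi _; set C3 := c 3 in c4 *; set C4 := c 4 in c4 *.
have a0 := beta_gt0 1; move: Y C3 C4 c4 => Y C3 C4.
rewrite m2 !big_nat1; set a := beta 1 in a0 *.
move=> c4 c3.
have {}c3 : C3 = 7 / (6 * a * (a + 1) * (a + 2)).
  apply: (@mulIf _ ((1 + 2) * (a + 2) * (1 + 2 * 2))); first by rewrite gt_eqF//; nra.
  by rewrite mulrA c3; field; rewrite !gt_eqF//; lra.
have {}c4 : C4 = 9 / (24 * a * (a + 1) * (a + 2) * (a + 3)).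
  apply: (@mulIf _ ((1 + 3) * (a + 3) * (1 + 2 * 3))); first by rewrite gt_eqF//; nra.
  by rewrite mulrA c4 c3; field; rewrite !gt_eqF//; lra.
rewrite c3 c4 !expr0 !expr1 mulr1.
have XE : (2 + 1) * a * (a + 1) / ((2 + 1) ^+ 2 * (a + 1) - (2 * 2 + 1) * a) =
  3 * a * (a + 1) / (4 * a + 9) by congr (_ / _); ring.
move: XE; set x := (2 + 1) * a * (a + 1) / _ => XE h.
apply: le_lt_trans (quartic_truncation_lt0 a0 XE).
rewrite -subr_ge0; move: h; congr (0 <= _); ring.
Qed.

Lemma Psi_lt0_of_Rayleigh : Psi X < 0.
Proof.
have [m2|m2] := leqP m 2; last exact: Psi_lt0_of_Rayleigh_ge3.
by apply: Psi_lt0_of_Rayleigh_2; apply/eqP; rewrite eqn_leq m2.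
Qed.

Lemma first_zero_Psi : exists r : R, [/\ A / (M + 1) < r, M * r < A, r < X, Psi r = 0 &
  forall x, 0 <= x < r -> 0 < Psi x].
Proof.
have A0 := prod_beta_gt0 m beta_gt0; have AB := prod_beta_lt m_gt1 beta_gt0.
have B0 := lt_trans A0 AB; have /andP[X0 XB] := Rayleigh_ratio_bounds.
have M2 : 2 <= M by rewrite ler_nat.
have [|||r [/andP[r0 rX] Pr Plt]] :=
  @first_zero _ Psi X (continuous_psum (exp_bounded_psi m_gt1 beta0 beta_gt0)).
- exact: ltW.
- by rewrite psum0 /psi phi0 mulr0 addr0 mulr1.
- exact: Psi_lt0_of_Rayleigh.
exists r; split => //; rewrite ltNge; apply/negP => h.
(* If [r <= A / (M + 1)], the truncation at order three is positive at [r]: [1 - c 1 * r] is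
   nonnegative and [c 2 * r ^ 2] exceeds [c 3 * r ^ 3]. As it bounds [Psi r = 0] from below, this is
   absurd. *)
- have rB : r < B.
    apply: (le_lt_trans h); rewrite ltr_pdivrMr; last by lra.
    by apply: (lt_trans AB); rewrite ltr_pMr//; lra.
  have rB' : 0 <= r <= B by rewrite !ltW.
  have := @Psi_alternating _ _ _ m_gt1 beta0 beta_gt0 4 r isT rB'.
  rewrite Pr !big_ord_recr big_ord0/= abs_psi0 abs_psi1//.
  have c3 : abs_psi m beta 3 * r < abs_psi m beta 2.
    apply: lt_le_trans (@abs_psi_decr _ _ _ m_gt1 beta0 beta_gt0 2 isT).
    by rewrite ltr_pM2l// abs_psi_gt0.
  have c1 : (M + 1) / A * r <= 1.
    by rewrite mulrAC ler_pdivrMr// mul1r mulrC -ler_pdivlMr//; lra.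
  have r2 : 0 < r ^+ 2 * (abs_psi m beta 2 - abs_psi m beta 3 * r).
    by rewrite mulr_gt0 ?subr_gt0// exprn_gt0.
  move=> h4; have : 0 < 0 :> R by rewrite [ltRHS](_ : _ =
    (1 - (M + 1) / A * r) + r ^+ 2 * (abs_psi m beta 2 - abs_psi m beta 3 * r)
    + - (1 - (M + 1) / A * r + r ^+ 2 * (abs_psi m beta 2 - abs_psi m beta 3 * r))); [lra|ring].
  by rewrite ltxx.
(* If [A / M <= r], then for [0 < x < A / M] the first two terms of [T_1] satisfy
   [M * x * (t 1 0 + t 1 1 * x) < 1], by comparison with [Q_1 / Phi]. This fails close to
   [A / M]. *)
- have t0 : t 1 0 = A^-1 by exact: tcoef_0.
  have t1 := tcoef11_gt0 m_gt1 beta0 beta_gt0.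
  pose s := A / M; have s0 : 0 < s by rewrite divr_gt0//; lra.
  have sr : s <= r by rewrite ler_pdivrMr 1?mulrC//; lra.
  (* At [x = s * th] the left side becomes [th * (1 + y * th)]; the factor [th] chosen below is the
     midpoint of [1 / (1 + y)] and [1]. *)
  pose y := A * t 1 1 * s; have y0 : 0 < y by rewrite mulr_gt0 ?s0// mulr_gt0 ?t1.
  (* [x] is less than [A / M], and yet [M * x * (t 1 0 + t 1 1 * x) >= 1]. *)
  pose x := s * ((2 + y) / (2 + 2 * y)).
  have x0 : 0 < x by rewrite mulr_gt0// divr_gt0//; lra.
  have xs : x < s by rewrite gtr_pMr// ltr_pdivrMr; lra.
  have [Phi0 Qlt] : 0 < Phi x /\ M * (x * Q 1 x) < Phi x.
    apply: (@Phi_gt0 _ _ _ m_gt1 beta0 beta_gt0 x); last by rewrite lexx ltW.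
    move=> z /andP[z0 zx]; apply: Plt; rewrite z0/=; lra.
  have Phi_ge z : 0 <= z <= x -> 0 <= Phi z.
    move=> zx; apply: ltW.
    have [] // := @Phi_gt0 _ _ _ m_gt1 beta0 beta_gt0 x _ z zx.
    move=> {zx}z /andP[z0 zx]; apply: Plt; rewrite z0/=; lra.
  have := @tcoef_le_qcoef _ _ _ m_gt1 beta0 beta_gt0 x Phi_ge 2 1 x (ltnW m_gt1).
  rewrite lexx (ltW x0) => /(_ isT).
  rewrite horner_poly !big_ord_recr big_ord0/= add0r expr0 expr1 mulr1 t0 => Qge.
  have : M * (x * ((A^-1 + t 1 1 * x) * Phi x)) < Phi x.
    by apply: le_lt_trans Qlt; rewrite ler_wpM2l ?ler_wpM2l//; lra.
  rewrite (mulrA x) (mulrA M) gtr_pMl// => {}Qlt.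
  suff : 1 <= M * (x * (A^-1 + t 1 1 * x)) by rewrite leNgt Qlt.
  have -> : M * (x * (A^-1 + t 1 1 * x)) = (2 + y) / (2 + 2 * y) * (1 + y * ((2 + y) / (2 + 2 * y))).
    rewrite /x; move: ((2 + y) / (2 + 2 * y)) => th.
    have Ms : M * s = A by rewrite mulrC divfK// gt_eqF//; lra.
    transitivity (M * s * (th * (A^-1 + t 1 1 * (s * th)))); first by ring.
    rewrite Ms mulrCA mulrDr mulfV ?gt_eqF// /y; congr (_ * (1 + _)).
    by rewrite !mulrA.
  rewrite -subr_ge0 [leRHS](_ : _ = y * (2 + 2 * y + y ^+ 2) / (2 + 2 * y) ^+ 2); last first.
    by field; rewrite gt_eqF//; lra.
  apply: divr_ge0; last by rewrite exprn_ge0//; lra.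
  by rewrite mulr_ge0 ?ltW// ?addr_gt0// ?exprn_gt0// mulr_gt0.
Qed.

End FirstZero.

(** * Complex power series *)

Section ComplexSeries.
Variable R : realType.
Local Notation C := (Cplx R).
Implicit Types (z w : C) (u v : nat -> C) (U V : nat -> R).

(** The norm of [R[i]] takes values in [R[i]]; this real-valued copy allows comparison with real
    series. *)
Definition cabs (z : R[i]) : R := complex.Re `|z|.

Lemma cabsE (z : R[i]) : `|z| = (cabs z)%:C.
Proof. by rewrite RRe_real ?normr_real. Qed.

Lemma cabs_ge0 (z : R[i]) : 0 <= cabs z.
Proof. by rewrite -ler0c -cabsE. Qed.

Lemma cabsM (x y : R[i]) : cabs (x * y) = cabs x * cabs y.
Proof. by apply: complexI; rewrite rmorphM/= -!cabsE normrM. Qed.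

Lemma cabsX (x : R[i]) n : cabs (x ^+ n) = cabs x ^+ n.
Proof. by apply: complexI; rewrite rmorphXn/= -!cabsE normrX. Qed.

Lemma cabs_real (x : R) : cabs x%:C = `|x|.
Proof. by rewrite /cabs normc_def/= expr0n/= addr0 sqrtr_sqr. Qed.

Lemma cabs0 : cabs 0 = 0.
Proof. by have := cabs_real 0; rewrite normr0. Qed.

Lemma ler_cabsD (x y : R[i]) : cabs (x + y) <= cabs x + cabs y.
Proof. by rewrite -lecR rmorphD/= -!cabsE ler_normD. Qed.

Lemma cabs_nat n : cabs n%:R = n%:R.
Proof. by have := cabs_real n%:R; rewrite rmorph_nat ger0_norm. Qed.

Lemma cabs_Re (z : R[i]) : `|complex.Re z| <= cabs z.
Proof. by rewrite -lecR -cabsE normc_ge_Re. Qed.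

Lemma cabs_Im (z : R[i]) : `|complex.Im z| <= cabs z.
Proof.
have := cabs_Re (z * 'i); rewrite ReiNIm normrN cabsM.
by rewrite [X in _ * X]/cabs normc_def/= expr0n/= add0r expr1n sqrtr1 mulr1.
Qed.

Lemma cvg_cabsP (u : nat -> C) (l : C) :
  u @ \oo --> l <-> (fun n => cabs (l - u n)) @ \oo --> (0 : R).
Proof.
split=> [/cvgrPdist_lt ul|ul].
  apply/cvgrPdist_lt => e e0; have := ul e%:C; rewrite ltcR => /(_ e0).
  apply: filterS => n; rewrite cabsE ltcR sub0r normrN ger0_norm//.
  exact: cabs_ge0.
apply/cvgrPdist_lt => e e0.
have eE : e = (complex.Re e)%:C by rewrite RRe_real// gtr0_real.
have /cvgrPdist_lt/(_ (complex.Re e)) := ul.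
rewrite -ltcR -eE => /(_ e0); apply: filterS => n.
rewrite sub0r normrN ger0_norm ?cabs_ge0// => h.
by rewrite cabsE eE ltcR.
Qed.

Lemma cvg_complex (u : nat -> C) (a b : R) :
  (fun n => complex.Re (u n)) @ \oo --> a -> (fun n => complex.Im (u n)) @ \oo --> b ->
  u @ \oo --> (Complex a b : C).
Proof.
move=> ua ub; apply/cvg_cabsP.
have h : (fun n => `|a - complex.Re (u n)| + `|b - complex.Im (u n)|) @ \oo --> (0 : R).
  rewrite -(addr0 0); apply: cvgD.
    by rewrite -(normr0 R) -(subrr a); apply: cvg_norm; apply: cvgB => //; exact: cvg_cst.
  by rewrite -(normr0 R) -(subrr b); apply: cvg_norm; apply: cvgB => //; exact: cvg_cst.
apply: (squeeze_cvgr _ (cvg_cst 0) h); near=> n.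
rewrite cabs_ge0/=; case: (u n) => x y.
have -> : (Complex a b - Complex x y : R[i]) = (a - x)%:C + 'i * (b - y)%:C.
  by apply/eqP; rewrite eq_complex/= !(mul0r, mul1r, mulr0, subr0, addr0, add0r) !eqxx.
apply: (le_trans (ler_cabsD _ _)); rewrite cabsM !cabs_real.
by rewrite [X in X * _]/cabs normc_def/= expr0n/= add0r expr1n sqrtr1 mul1r.
Unshelve. all: by end_near. Qed.

Lemma cvg_real_complex (a : nat -> R) (l : R) : a @ \oo --> l ->
  (fun n => (a n)%:C : C) @ \oo --> (l%:C : C).
Proof. by move=> al; apply: cvg_complex => //=; exact: cvg_cst. Qed.

Lemma Re_sum (I : Type) (r : seq I) (F : I -> R[i]) :
  complex.Re (\sum_(i <- r) F i) = \sum_(i <- r) complex.Re (F i).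
Proof. by elim/big_rec2 : _ => // i x y _ <-; case: (F i) y => ? ? []. Qed.

Lemma Im_sum (I : Type) (r : seq I) (F : I -> R[i]) :
  complex.Im (\sum_(i <- r) F i) = \sum_(i <- r) complex.Im (F i).
Proof. by elim/big_rec2 : _ => // i x y _ <-; case: (F i) y => ? ? []. Qed.

Lemma is_cvg_cseries u V : (forall n, cabs (u n) <= V n) -> cvgn (series V) ->
  cvgn (series u : nat -> C).
Proof.
move=> uV cV; have V0 n : 0 <= V n by apply: le_trans (uV n); exact: cabs_ge0.
have cRe : cvgn (series (fun n => complex.Re (u n))).
  apply: normed_cvg; apply: (@series_le_cvg _ _ V) => // n; first exact: normr_ge0.
  by apply: le_trans (uV n); exact: cabs_Re.
have cIm : cvgn (series (fun n => complex.Im (u n))).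
  apply: normed_cvg; apply: (@series_le_cvg _ _ V) => // n; first exact: normr_ge0.
  by apply: le_trans (uV n); exact: cabs_Im.
apply/cvg_ex; eexists; apply: cvg_complex.
- have -> : (fun n => complex.Re (series u n)) = series (fun n => complex.Re (u n)).
    by apply/funext => n; rewrite /series/= Re_sum.
  exact: cRe.
- have -> : (fun n => complex.Im (series u n)) = series (fun n => complex.Im (u n)).
    by apply/funext => n; rewrite /series/= Im_sum.
  exact: cIm.
Qed.

Lemma cabs_lim_le u (l : C) (M : R) : u @ \oo --> l -> (forall n, cabs (u n) <= M) ->
  cabs l <= M.
Proof.
move=> /cvg_cabsP ul uM.
have h : (fun n => cabs (l - u n) + M) @ \oo --> 0 + M by apply: cvgD => //; exact: cvg_cst.
rewrite -(add0r M) -(cvg_lim _ h)//; apply: limr_ge.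
  by apply/cvg_ex; eexists; exact: h.
near=> n; rewrite -{1}(subrK (u n) l); apply: (le_trans (ler_cabsD _ _)).
by rewrite lerD2l.
Unshelve. all: by end_near. Qed.

Lemma cabs_sum (I : Type) (r : seq I) (F : I -> R[i]) :
  cabs (\sum_(i <- r) F i) <= \sum_(i <- r) cabs (F i).
Proof.
rewrite -lecR -cabsE (le_trans (ler_norm_sum _ _ _))// rmorph_sum/=.
by apply: ler_sum => i _; rewrite cabsE.
Qed.

Lemma cabs_series_le u V (l : C) : series u @ \oo --> l ->
  (forall n, cabs (u n) <= V n) -> cvgn (series V) -> cabs l <= limn (series V).
Proof.
move=> ul uV cV; have V0 n : 0 <= V n by apply: le_trans (uV n); exact: cabs_ge0.
apply: (cabs_lim_le ul) => n; apply: (le_trans (cabs_sum _ _)).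
apply: (@le_trans _ _ (series V n)); first by apply: ler_sum => i _.
by apply: nondecreasing_cvgn_le => //; exact: nondecreasing_series.
Qed.

End ComplexSeries.

(** * Cauchy products of absolutely convergent series *)

Section CauchyProduct.

Lemma sum_conv (F : comNzRingType) (u v : nat -> F) N :
  \sum_(0 <= k < N) conv u v k = \sum_(0 <= i < N) u i * \sum_(0 <= j < N - i) v j.
Proof.
elim: N => [|N IHN]; first by rewrite !big_geq.
rewrite big_nat_recr//= IHN /conv -(big_mkord xpredT (fun j => u j * v (N - j)%N)).
rewrite !big_nat_recr//= subnn subSnn big_nat1 addrA -big_split/=; congr (_ + _).
rewrite !big_nat; apply: eq_bigr => i /= iN.
by rewrite subSn ?(ltnW iN)// big_nat_recr//= mulrDr.
Qed.

Variable R : realType.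
Implicit Types (U V : nat -> R) (u v : nat -> Cplx R).

(** The triangle [i + j < n] lies in the square of side [n], itself inside the triangle of size
    [2 n]; with nonnegative terms the partial sums are squeezed. *)
Lemma cvg_series_conv_ge0 U V (a b : R) : (forall n, 0 <= U n) -> (forall n, 0 <= V n) ->
  series U @ \oo --> a -> series V @ \oo --> b -> series (conv U V) @ \oo --> a * b.
Proof.
move=> U0 V0 Ua Vb.
have UV : (fun n => series U n * series V n) @ \oo --> a * b by exact: cvgM.
have sV n p : (n <= p)%N -> series V n <= series V p by move=> np; exact: nondecreasing_series.
have sV0 n : 0 <= series V n by apply: sumr_ge0.
have C0 n : 0 <= conv U V n by apply: sumr_ge0 => i _; rewrite mulr_ge0.
have Cle n : series (conv U V) n <= series U n * series V n.
  rewrite /series/= sum_conv mulr_suml; apply: ler_sum => i _.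
  by rewrite ler_wpM2l//; apply: sV; exact: leq_subr.
have leC n : series U n * series V n <= series (conv U V) (n + n)%N.
  rewrite /series/= sum_conv (big_cat_nat (leq0n n) (leq_addr n n)) mulr_suml.
  apply: ler_wpDr.
    by apply: sumr_ge0 => i _; rewrite mulr_ge0//; exact: sV0.
  rewrite [leLHS]big_nat [leRHS]big_nat; apply: ler_sum => i /= iN; rewrite ler_wpM2l//.
  by apply: sV; rewrite -addnBA ?leq_addr// ltnW.
have ndC : nondecreasing_seq (series (conv U V)) by exact: nondecreasing_series.
have ndUV : nondecreasing_seq (fun n => series U n * series V n).
  move=> n p np; apply: ler_pM => //; [exact: sumr_ge0| |exact: sV].
  exact: nondecreasing_series.
have UVle n : series U n * series V n <= a * b.
  by rewrite -(cvg_lim _ UV)//; apply: (nondecreasing_cvgn_le ndUV); apply/cvg_ex; eexists; exact: UV.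
have cC : cvgn (series (conv U V)).
  by apply: nondecreasing_is_cvgn => //; exists (a * b) => _ [n _ <-]; exact: le_trans (UVle n).
suff <- : limn (series (conv U V)) = a * b by [].
apply/eqP; rewrite eq_le; apply/andP; split.
  by apply: limr_le => //; near=> n; exact: le_trans (UVle n).
rewrite -(cvg_lim _ UV)//; apply: limr_le; first by apply/cvg_ex; eexists; exact: UV.
by near=> n; apply: (le_trans (leC n)); exact: nondecreasing_cvgn_le.
Unshelve. all: by end_near. Qed.

(** The gap between square and triangle sums is at most the same gap for the majorants, which tends
    to [0] by the nonnegative case. *)
Lemma cvg_series_conv u v U V (a b : Cplx R) :
  (forall n, cabs (u n) <= U n) -> (forall n, cabs (v n) <= V n) ->
  cvgn (series U) -> cvgn (series V) ->
  series u @ \oo --> a -> series v @ \oo --> b ->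
  (series (conv u v) : nat -> Cplx R) @ \oo --> a * b.
Proof.
move=> uU vV cU cV ua vb.
have U0 n : 0 <= U n by apply: le_trans (uU n); exact: cabs_ge0.
have V0 n : 0 <= V n by apply: le_trans (vV n); exact: cabs_ge0.
have UV := cvg_series_conv_ge0 U0 V0 cU cV.
have uv : (fun n => series u n * series v n : Cplx R) @ \oo --> (a * b : Cplx R).
  exact: (@cvgM R[i] _ _ _ (series u) (series v) a b ua vb).
pose r n := series U n * series V n - series (conv U V) n.
have r0 : r @ \oo --> (0 : R).
  by rewrite -(subrr (limn (series U) * limn (series V))); apply: cvgB => //; exact: cvgM.
have err n : cabs (series u n * series v n - series (conv u v) n) <= r n.
  rewrite /r /series/= !sum_conv !mulr_suml -!sumrB.
  apply: (le_trans (cabs_sum _ _)); rewrite [leLHS]big_nat [leRHS]big_nat; apply: ler_sum => i /= iN.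
  rewrite -!mulrBr cabsM; apply: ler_pM; rewrite ?cabs_ge0//.
  rewrite [in X in cabs X](big_cat_nat (leq0n (n - i)) (leq_subr i n))
    [in X in _ <= X](big_cat_nat (F := V) (leq0n (n - i)) (leq_subr i n)).
  rewrite [X in cabs X]addrC addKr [leRHS]addrC addKr; apply: (le_trans (cabs_sum _ _)).
  exact: ler_sum.
apply/cvg_cabsP.
move/cvg_cabsP in uv.
have h : (fun n => cabs (a * b - series u n * series v n) + r n) @ \oo --> (0 : R).
  by rewrite -(addr0 0); exact: cvgD.
apply: (squeeze_cvgr _ (cvg_cst 0) h); near=> n.
rewrite cabs_ge0/= -[in X in cabs X <= _](subrK (series u n * series v n) (a * b)) -addrA.
by apply: (le_trans (ler_cabsD _ _)); rewrite lerD2l.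
Unshelve. all: by end_near. Qed.

End CauchyProduct.

Section ComplexPowerSeries.
Variable R : realType.
Local Notation C := (Cplx R).
Implicit Types (z w : C) (c : nat -> R).

Definition cterm c z : nat -> C := fun n => (c n)%:C * z ^+ n.
Definition csum c z : C := limn (series (cterm c z) : nat -> C).
Definition summable_at c (x : R) := cvgn (series (fun n => `|c n| * x ^+ n)).

Lemma cabs_cterm c z n : cabs (cterm c z n) = `|c n| * cabs z ^+ n.
Proof. by rewrite cabsM cabsX cabs_real. Qed.

Lemma cvg_csum c z : summable_at c (cabs z) -> series (cterm c z) @ \oo --> csum c z.
Proof. by move=> h; apply: is_cvg_cseries h => n; rewrite cabs_cterm. Qed.

Lemma csum_conv a b z : summable_at a (cabs z) -> summable_at b (cabs z) ->
  csum (conv a b) z = csum a z * csum b z.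
Proof.
move=> ha hb; apply: cvg_lim; first exact: norm_hausdorff.
have -> : cterm (conv a b) z = conv (cterm a z) (cterm b z).
  apply/funext => n; rewrite /cterm /conv rmorph_sum/= mulr_suml; apply: eq_bigr => i _.
  rewrite rmorphM/= mulrACA -exprD subnKC//; by rewrite -ltnS.
by apply: cvg_series_conv ha hb (cvg_csum ha) (cvg_csum hb) => n; rewrite cabs_cterm.
Qed.

Lemma csumD_mulX a b (s : R) z : summable_at a (cabs z) -> summable_at b (cabs z) ->
  csum (fun k => a k + s * mulX b k) z = csum a z + s%:C * (z * csum b z).
Proof.
move=> ha hb; apply: cvg_lim; first exact: norm_hausdorff.
have -> : series (cterm (fun k => a k + s * mulX b k) z) =
    series (cterm a z) + (s%:C \*: series (cterm (mulX b) z)).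
  apply/funext => n; rewrite addrfctE /series/= scaler_sumr -big_split; apply: eq_bigr => i _.
  by rewrite /cterm/= rmorphD rmorphM/= mulrDl -mulrA.
apply: cvgD; first exact: cvg_csum.
apply: cvgZl_tmp; rewrite -cvg_shiftS.
have -> : [sequence series (cterm (mulX b) z) n.+1]_n = z \*: series (cterm b z).
  apply/funext => n; rewrite /series/= big_nat_recl// /cterm/= mul0r add0r scaler_sumr.
  by apply: eq_bigr => i _; rewrite exprS mulrCA.
by apply: cvgZl_tmp; exact: cvg_csum.
Qed.

Lemma csum_one z : csum one_series z = 1.
Proof.
apply: cvg_lim; first exact: norm_hausdorff.
rewrite -cvg_shiftS.
have -> : [sequence series (cterm one_series z) n.+1]_n = cst 1.
  apply/funext => n; rewrite /series/= big_nat_recl// /cterm expr0 mulr1 /one_series eqxx.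
  by rewrite big1 ?addr0// => i _; rewrite mul0r.
exact: cvg_cst.
Qed.

Lemma exp_bounded_summable_at c x : exp_bounded c -> 0 <= x -> summable_at c x.
Proof.
move=> ec x0; have := exp_bounded_summable (x := x) ec.
suff -> : (fun n => `|c n * x ^+ n|) = (fun n => `|c n| * x ^+ n) by [].
by apply/funext => n; rewrite normrM [X in _ * X]ger0_norm// exprn_ge0.
Qed.

Lemma csum_real c (x : R) : exp_bounded c -> csum c x%:C = (psum c x)%:C.
Proof.
move=> ec; apply: cvg_lim; first exact: norm_hausdorff.
have -> : series (cterm c x%:C) = (fun n => (pseries c x n)%:C).
  apply/funext => n; rewrite /pseries /series/= rmorph_sum/=; apply: eq_bigr => i _.
  by rewrite rmorphM rmorphXn.
exact/cvg_real_complex/exp_bounded_cvg.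
Qed.

End ComplexPowerSeries.

(** * Termwise complex differentiation *)

Section ComplexDerivative.
Variable R : realType.
Local Notation C := (Cplx R).

(** The remainder [R_n] satisfies [R_(n+1) = (z + h) R_n + n h^2 z^(n-1)], whence the bound
    [|h|^2 n^2 r^n] by induction. Then [n^2 <= 4^n] makes it a term of a power series at [4 r]. *)
Lemma cabs_taylor1 (z h : R[i]) (r : R) n : 1 <= r -> cabs z <= r -> cabs (z + h) <= r ->
  cabs ((z + h) ^+ n - z ^+ n - n%:R * h * z ^+ n.-1) <= cabs h ^+ 2 * (4 * r) ^+ n.
Proof.
move=> r1 zr zhr; have r0 : 0 <= r by exact: le_trans r1.
suff : cabs ((z + h) ^+ n - z ^+ n - n%:R * h * z ^+ n.-1) <=
    cabs h ^+ 2 * (n%:R ^+ 2 * r ^+ n).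
  move/le_trans; apply; rewrite exprMn ler_wpM2l ?exprn_ge0 ?cabs_ge0// ler_wpM2r ?exprn_ge0//.
  rewrite -!natrX ler_nat (_ : 4 = 2 ^ 2)%N// -expnM mulnC expnM leq_exp2r//.
  exact/ltnW/ltn_expl.
elim: n => [|n IHn]; first by rewrite !expr0 subrr !mul0r subr0 cabs0 !mulr_ge0 ?exprn_ge0 ?cabs_ge0.
have -> : (z + h) ^+ n.+1 - z ^+ n.+1 - n.+1%:R * h * z ^+ n.+1.-1 =
    (z + h) * ((z + h) ^+ n - z ^+ n - n%:R * h * z ^+ n.-1) + n%:R * (h ^+ 2 * z ^+ n.-1).
  case: n {IHn} => [|n]; first by rewrite !expr0 !expr1; ring.
  by rewrite !exprS/=; ring.
apply: (le_trans (ler_cabsD _ _)); rewrite !cabsM !cabsX cabs_nat.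
have zn : cabs z ^+ n.-1 <= r ^+ n.+1.
  apply: (@le_trans _ _ (r ^+ n.-1)); first by rewrite lerXn2r// nnegrE cabs_ge0.
  by rewrite ler_weXn2l//; lia.
have H0 : 0 <= cabs h ^+ 2 by rewrite exprn_ge0 ?cabs_ge0.
apply: (@le_trans _ _ (r * (cabs h ^+ 2 * (n%:R ^+ 2 * r ^+ n)) + n%:R * (cabs h ^+ 2 * r ^+ n.+1))).
  apply: lerD; first by rewrite ler_pM ?cabs_ge0.
  by rewrite ler_wpM2l// ler_wpM2l.
have -> : r * (cabs h ^+ 2 * (n%:R ^+ 2 * r ^+ n)) + n%:R * (cabs h ^+ 2 * r ^+ n.+1) =
  cabs h ^+ 2 * ((n%:R ^+ 2 + n%:R) * r ^+ n.+1) by rewrite [r ^+ n.+1]exprS; ring.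
rewrite ler_wpM2l// ler_wpM2r ?exprn_ge0// -!natrX -natrD ler_nat; lia.
Qed.

(* The exponents [e n] are arbitrary so that [J] and [f], whose terms have exponents
   [n * (d + 1)] and [n * (d + 1) + 1], are differentiated without a chain rule. *)
Variables (a : nat -> R) (e : nat -> nat).
Hypothesis cvg_a : forall x, 0 <= x -> cvgn (series (fun n => `|a n| * x ^+ e n)).
Local Notation term z := (fun n => (a n)%:C * z ^+ e n : C).
Local Notation dterm z := (fun n => (a n)%:C * ((e n)%:R * z ^+ (e n).-1) : C).
Local Notation g := (fun z : C => limn (series (term z) : nat -> C)).

Lemma cvg_lacunary (z : C) : (series (term z) : nat -> C) @ \oo --> g z.
Proof.
apply: is_cvg_cseries (cvg_a (cabs_ge0 z)) => n.
by rewrite cabsM cabsX cabs_real.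
Qed.

Lemma cvg_lacunary_deriv (z : C) : cvgn (series (dterm z) : nat -> C).
Proof.
pose r := cabs z + 1; have r1 : 1 <= r by rewrite lerDr cabs_ge0.
have r0 : 0 <= 4 * r by rewrite mulr_ge0//; exact: le_trans r1.
apply: is_cvg_cseries (cvg_a r0) => n; rewrite !cabsM cabsX cabs_real cabs_nat.
rewrite ler_wpM2l// exprMn; apply: ler_pM => //; first by rewrite exprn_ge0 ?cabs_ge0.
  rewrite -natrX ler_nat; apply/ltnW/(leq_trans (ltn_expl (e n) (isT : 1 < 2)%N)).
  by case: (e n) => [|k] //; rewrite leq_exp2r.
apply: (@le_trans _ _ (r ^+ (e n).-1)).
  by rewrite lerXn2r// ?nnegrE ?cabs_ge0// ?lerDl// addr_ge0 ?cabs_ge0.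
by rewrite ler_weXn2l// leq_pred.
Qed.

(** Summing the Taylor bounds over the terms gives [|g (z + h) - g z - h G| <= |h|^2 M] for
    [|h| <= 1], with [M] the majorant series at [4 (|z| + 1)]. *)
Lemma derive1_lacunary (z : C) : derive1 g z = limn (series (dterm z) : nat -> C).
Proof.
set G := limn _; apply: cvg_lim; first exact: norm_hausdorff.
pose r := cabs z + 1; have r1 : 1 <= r by rewrite lerDr cabs_ge0.
have r0 : 0 <= 4 * r by rewrite mulr_ge0//; exact: le_trans r1.
pose M := limn (series (fun n => `|a n| * (4 * r) ^+ e n)).
have M0 : 0 <= M.
  apply: limr_ge; first exact: cvg_a.
  by apply: nearW => n; apply: sumr_ge0 => i _; rewrite mulr_ge0// exprn_ge0.
have bound (h : C) : cabs h <= 1 -> cabs (g (h + z) - g z - h * G) <= cabs h ^+ 2 * M.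
  move=> h1.
  have cv : (series (fun n => (a n)%:C * ((z + h) ^+ e n - z ^+ e n - (e n)%:R * h * z ^+ (e n).-1) : C)
      : nat -> C) @ \oo --> g (h + z) - g z - h * G.
    have -> : series (fun n =>
        (a n)%:C * ((z + h) ^+ e n - z ^+ e n - (e n)%:R * h * z ^+ (e n).-1) : C) =
        series (term (h + z)) - series (term z) - (h \*: series (dterm z)).
      apply/funext => n; rewrite !fctE /series/= scaler_sumr -!sumrB; apply: eq_bigr => i _.
      by rewrite [h + z]addrC /GRing.scale/=; ring.
    apply: cvgB; first by apply: cvgB; exact: cvg_lacunary.
    by apply: cvgZl_tmp; exact: cvg_lacunary_deriv.
  rewrite /M -[leRHS]lim_seriesZ; last exact: cvg_a.
  apply: (cabs_series_le cv); last exact/is_cvg_seriesZ/cvg_a.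
  move=> n; rewrite scalrfctE cabsM cabs_real /GRing.scale/= [leRHS]mulrCA ler_wpM2l//.
  apply: cabs_taylor1 => //; first by rewrite lerDl.
  by apply: (le_trans (ler_cabsD _ _)); rewrite lerD2l.
apply/cvgrPdist_lt => eps eps0.
have epsE : eps = (complex.Re eps)%:C by rewrite RRe_real// gtr0_real.
have eps0' : 0 < complex.Re eps by rewrite -ltcR -epsE.
pose del := Num.min 1 (complex.Re eps / (M + 1)).
have del0 : 0 < del by rewrite lt_min ltr01 divr_gt0// ltr_wpDl.
near=> h.
have h0 : h != 0 by near: h; exact: nbhs_dnbhs_neq.
have hd : cabs h < del.
  rewrite -ltcR -cabsE; near: h; apply: dnbhs0_lt; by rewrite ltcR.
have [h1 h2] : cabs h <= 1 /\ cabs h * (M + 1) < complex.Re eps.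
  by move: hd; rewrite lt_min => /andP[/ltW h1]; rewrite ltr_pdivlMr ?ltr_wpDl.
have hh : 0 < cabs h by rewrite -ltcR -cabsE normr_gt0.
rewrite epsE cabsE ltcR -[G](mulKf h0).
have -> : h^-1 * (h * G) - h^-1 *: (g (h + z) - g z) = - h^-1 * (g (h + z) - g z - h * G).
  by rewrite mulNr mulrBr opprB.
rewrite cabsM; apply: (@le_lt_trans _ _ (cabs h * M)); last first.
  by apply: le_lt_trans h2; rewrite ler_wpM2l ?lerDl// ltW.
have cabsV : cabs (- h^-1) = (cabs h)^-1.
  apply: (mulIf (lt0r_neq0 hh)); rewrite mulVf ?gt_eqF// -cabsM mulNr mulVf//.
  by rewrite -[X in cabs (- X)](rmorph1 (real_complex R)) -rmorphN cabs_real normrN normr1.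
rewrite cabsV ler_pdivrMl// mulrA -expr2; exact: bound.
Unshelve. all: by end_near. Qed.

End ComplexDerivative.

(** * The starlikeness quotient *)

Section StarlikeQuotient.
Variables (R : realType) (m : nat) (beta : nat -> R).
Hypotheses (m_gt1 : (1 < m)%N) (beta0 : beta 0 = 1) (beta_gt0 : forall i, 0 < beta i).
Local Notation phi := (phi m beta).
Local Notation q := (qcoef m beta).
Local Notation t := (tcoef m beta).
Local Notation psi := (psi m beta).

Lemma csum_phi (w : Cplx R) : csum phi w = 1 - w * csum (q 0) w.
Proof.
have -> : phi = fun k => one_series k + (-1) * mulX (q 0) k.
  apply/funext => -[|k]; first by rewrite phi0 mulr0 addr0.
  by rewrite phiS// mulN1r add0r.
rewrite csumD_mulX ?csum_one ?rmorphN ?rmorph1 ?mulN1r//.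
- by apply: exp_bounded_summable_at; [exact: exp_bounded_one|exact: cabs_ge0].
- by apply: exp_bounded_summable_at; [exact: exp_bounded_qcoef|exact: cabs_ge0].
Qed.

Lemma csum_psi (w : Cplx R) : csum psi w = csum phi w - m%:R * (w * csum (q 1) w).
Proof.
have -> : psi = fun k => phi k + (- m%:R) * mulX (q 1) k.
  apply/funext => k; rewrite /psi mulrDl mul1r mulNr -mulrN; congr (_ + _).
  have /(congr1 (@^~ k)) := euler_phi m_gt1 beta0 beta_gt0.
  by rewrite /euler -mulrA => ->; case: k => [|k] //=; rewrite oppr0.
rewrite csumD_mulX ?rmorphN ?rmorph_nat ?mulNr//.
- by apply: exp_bounded_summable_at; [exact: exp_bounded_phi|exact: cabs_ge0].
- by apply: exp_bounded_summable_at; [exact: exp_bounded_qcoef|exact: cabs_ge0].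
Qed.

(** At [x = |w|] the partial sums of [T_i] stay below [Q_i / Phi], so [Q_i = phi T_i] holds at [w]
    as a Cauchy product. Then [psi / phi = 1 - m w T_1], and [|m w T_1| <= m x Q_1 / Phi < 1], the
    last two evaluated at [x]. *)
Lemma csum_psi_div_phi (w : Cplx R) :
  (forall x, 0 <= x <= cabs w -> 0 < psum psi x) ->
  csum phi w != 0 /\ 0 < complex.Re (csum psi w / csum phi w).
Proof.
set x := cabs w => Psi0; have x0 : 0 <= x by exact: cabs_ge0.
have Phi0 := Phi_gt0 m_gt1 beta0 beta_gt0 Psi0.
have [Phix Qx] := Phi0 x (introT andP (conj x0 (lexx x))).
have Phi_ge y : 0 <= y <= x -> 0 <= psum phi y by move=> /Phi0[/ltW].
have bnd i n : (i <= m)%N -> series (fun k => `|t i k| * x ^+ k) n <= psum (q i) x / psum phi x.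
  move=> im; rewrite ler_pdivlMr//.
  have := tcoef_le_qcoef m_gt1 beta0 beta_gt0 Phi_ge n im (introT andP (conj x0 (lexx x))).
  apply: le_trans; rewrite ler_wpM2r ?(ltW Phix)// horner_poly /series/= big_mkord.
  by apply: ler_sum => k _; rewrite ger0_norm// tcoef_ge0.
have sum_t i : (i <= m)%N -> summable_at (t i) x.
  move=> im; apply: nondecreasing_is_cvgn.
    by apply: nondecreasing_series => n _ _; rewrite mulr_ge0 ?exprn_ge0.
  by exists (psum (q i) x / psum phi x) => _ [n _ <-]; exact: bnd.
have sum_phi : summable_at phi x by apply: exp_bounded_summable_at => //; exact: exp_bounded_phi.
have m1 : (1 <= m)%N by exact: ltnW.
have qE i : (i <= m)%N -> csum (q i) w = csum phi w * csum (t i) w.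
  by move=> im; rewrite -conv_phi_tcoef// csum_conv//; exact: sum_t.
have phi_neq0 : csum phi w != 0.
  apply/eqP => phiw; have := csum_phi w.
  rewrite qE// phiw mul0r mulr0 subr0 => /eqP; by rewrite eq_sym oner_eq0.
split=> //.
have t1 : cabs (csum (t 1) w) <= psum (q 1) x / psum phi x.
  apply: (@le_trans _ _ (limn (series (fun k => `|t 1 k| * x ^+ k)))).
    by apply: (cabs_series_le (cvg_csum (sum_t 1 m1)) _ (sum_t 1 m1)) => n; rewrite cabs_cterm.
  by apply: limr_le; [exact: sum_t|apply: nearW => n; exact: bnd].
have -> : csum psi w / csum phi w = 1 - m%:R * (w * csum (t 1) w).
  by rewrite csum_psi qE//; field.
have lt1 : cabs (m%:R * (w * csum (t 1) w)) < 1.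
  rewrite !cabsM cabs_nat; apply: (@le_lt_trans _ _ (m%:R * (x * (psum (q 1) x / psum phi x)))).
    by rewrite ler_wpM2l// ler_wpM2l.
  by rewrite !mulrA ltr_pdivrMr// mul1r -mulrA.
have := le_lt_trans (ler_norm _) (le_lt_trans (cabs_Re _) lt1).
by case: (m%:R * (w * csum (t 1) w)) => a b /=; rewrite subr_gt0.
Qed.

End StarlikeQuotient.

(** * The hyper-Bessel function in the variable w *)

Section HyperBesselSeries.
Variables (R : realType) (d : nat) (alpha : 'I_d -> R).
Local Notation C := (Cplx R).
Local Notation K := (d.+1%:R).

(* The parameters [beta_0 = 1], which accounts for the factorial, and [beta_i = alpha_i + 1]. *)
Definition hbeta i : R :=
  if i is j.+1 then oapp (fun k => alpha k + 1) 1 (insub j) else 1.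

Local Notation phi := (phi d.+1 hbeta).
Local Notation psi := (psi d.+1 hbeta).

Lemma prod_hbeta (G : R -> R) :
  \prod_(1 <= i < d.+1) G (hbeta i) = \prod_(i < d) G (alpha i + 1).
Proof.
by rewrite big_add1/= big_mkord; apply: eq_bigr => i _; rewrite /= valK.
Qed.

Lemma hyper_bessel_coefE n : hyper_bessel_coef alpha n = phi n.
Proof.
rewrite /hyper_bessel_coef /phi; congr (_ / _).
under [RHS]eq_bigr do rewrite big_ltn//.
rewrite big_split/=; congr (_ * _).
  by rewrite fact_prod natr_prod big_add1/=; apply: eq_bigr => i _; rewrite nat1r.
under [RHS]eq_bigr do rewrite (prod_hbeta (fun b => b + _)).
by rewrite exchange_big.
Qed.

Hypothesis halpha : forall i : 'I_d, -1 < alpha i.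

(** Beyond index [d] the default value [1] of [hbeta] keeps positivity for all [i]. *)
Lemma hbeta_gt0 i : 0 < hbeta i.
Proof.
case: i => [|j] //=; case: insub => [i|] //=.
by rewrite -ltrBlDr sub0r.
Qed.

End HyperBesselSeries.

Section HyperBesselDerivative.
Variables (R : realType) (d : nat) (alpha : 'I_d -> R).
Hypotheses (hd : (1 <= d)%N) (halpha : forall i : 'I_d, -1 < alpha i).
Local Notation C := (Cplx R).
Local Notation phi := (phi d.+1 (hbeta alpha)).
Local Notation psi := (psi d.+1 (hbeta alpha)).

Definition power_arg (z : C) : C := (z / d.+1%:R) ^+ d.+1.

Let a n : R := phi n / d.+1%:R ^+ (n * d.+1).

Lemma hyper_bessel_termE (z : C) n :
  (hyper_bessel_coef alpha n)%:C * (z / d.+1%:R) ^+ (n * d.+1) = cterm phi (power_arg z) n.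
Proof. by rewrite hyper_bessel_coefE /cterm /power_arg mulnC exprM. Qed.

Lemma hyper_bessel_csum (z : C) : hyper_bessel alpha z = csum phi (power_arg z).
Proof.
rewrite /hyper_bessel /csum; congr (limn (series _)).
by apply/funext => n; exact: hyper_bessel_termE.
Qed.

Lemma lacunary_termE (z : C) n : (a n)%:C * z ^+ (n * d.+1) = cterm phi (power_arg z) n.
Proof.
rewrite /a rmorphM/= fmorphV rmorphXn rmorph_nat /cterm /power_arg -exprM mulnC.
by rewrite exprMn exprVn -mulrA; congr (_ * _); rewrite mulrC.
Qed.

Lemma cvg_lacunary_abs (x : R) e : 0 <= x ->
  cvgn (series (fun n => `|a n| * x ^+ (n * d.+1 + e))).
Proof.
move=> x0; have k0 : 0 <= (d.+1%:R)^-1 :> R by rewrite invr_ge0.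
have ephi := exp_bounded_phi (hd : (1 < d.+1)%N) (erefl : hbeta alpha 0 = 1) (hbeta_gt0 halpha).
have h : summable_at phi ((x / d.+1%:R) ^+ d.+1).
  by apply: exp_bounded_summable_at => //; rewrite exprn_ge0// mulr_ge0.
have -> : (fun n => `|a n| * x ^+ (n * d.+1 + e)) =
    x ^+ e *: (fun n => `|phi n| * ((x / d.+1%:R) ^+ d.+1) ^+ n).
  apply/funext => n; rewrite scalrfctE /GRing.scale/= /a normrM normfV normrX normr_nat.
  rewrite exprD -exprM mulnC exprMn exprVn; ring.
exact: is_cvg_seriesZ.
Qed.

(** [z d/dz] multiplies the term of degree [n (d + 1)] by its degree, so the sum has coefficients
    [(1 + (d + 1) n) phi n = psi n]. *)
Lemma derive1_hyper_bessel (z : C) :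
  z * derive1 (hyper_bessel alpha) z + hyper_bessel alpha z = csum psi (power_arg z).
Proof.
have cv (x : R) : 0 <= x -> cvgn (series (fun n => `|a n| * x ^+ (n * d.+1))).
  by move=> x0; have := @cvg_lacunary_abs x 0 x0; under eq_fun do rewrite addn0.
have -> : hyper_bessel alpha = fun z : C =>
    limn (series (fun n => (a n)%:C * z ^+ (n * d.+1) : C) : nat -> C).
  apply/funext => y; rewrite hyper_bessel_csum /csum; congr (limn (series _)).
  by apply/funext => n; rewrite lacunary_termE.
rewrite (derive1_lacunary cv); apply/esym/cvg_lim; first exact: norm_hausdorff.
have -> : series (cterm psi (power_arg z)) =
    z \*: series (fun n => (a n)%:C * ((n * d.+1)%:R * z ^+ (n * d.+1).-1) : C)
    + series (fun n => (a n)%:C * z ^+ (n * d.+1) : C).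
  apply/funext => n; rewrite !fctE /series/= scaler_sumr -big_split; apply: eq_bigr => i _ /=.
  rewrite /cterm /psi rmorphM/= -mulrA -[_%:C * power_arg z ^+ i]/(cterm phi (power_arg z) i).
  rewrite -lacunary_termE rmorphD rmorph1 rmorphM !rmorph_nat mulrDl mul1r addrC; congr (_ + _).
  rewrite -[_ *: _]/(_ * _) mulnC natrM; case: i => [|i]; first by rewrite !mulr0 !mul0r !mulr0.
  by rewrite mulSn addSn /= exprS; ring.
apply: cvgD; last exact: cvg_lacunary.
by apply: cvgZl_tmp; exact: cvg_lacunary_deriv.
Qed.

Lemma derive1_hyper_bessel_f (z : C) :
  derive1 (hyper_bessel_f alpha) z = csum psi (power_arg z).
Proof.
have cv (x : R) : 0 <= x -> cvgn (series (fun n => `|a n| * x ^+ (n * d.+1 + 1))).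
  exact: cvg_lacunary_abs.
have cv0 (x : R) : 0 <= x -> cvgn (series (fun n => `|a n| * x ^+ (n * d.+1))).
  by move=> x0; have := @cvg_lacunary_abs x 0 x0; under eq_fun do rewrite addn0.
have -> : hyper_bessel_f alpha = fun z : C =>
    limn (series (fun n => (a n)%:C * z ^+ (n * d.+1 + 1) : C) : nat -> C).
  apply/funext => y; rewrite /hyper_bessel_f hyper_bessel_csum.
  apply/esym/cvg_lim; first exact: norm_hausdorff.
  have -> : series (fun n => (a n)%:C * y ^+ (n * d.+1 + 1) : C) =
      y \*: series (cterm phi (power_arg y)).
    apply/funext => n; rewrite /series/= scaler_sumr; apply: eq_bigr => i _.
    by rewrite -lacunary_termE addn1 exprS mulrCA.
  apply: cvgZl_tmp; have := cvg_lacunary cv0 (z := y).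
  suff -> : (fun n => (a n)%:C * y ^+ (n * d.+1) : C) = cterm phi (power_arg y) by [].
  by apply/funext => n; rewrite lacunary_termE.
rewrite (derive1_lacunary cv) /csum; congr (limn (series _)); apply/funext => n.
rewrite addn1 /= mulrCA lacunary_termE /cterm mulrA; congr (_ * _).
rewrite [RHS]rmorphM; congr (_ * _).
by rewrite rmorphD rmorph1 rmorphM !rmorph_nat -natrM nat1r mulnC.
Qed.

Lemma cabs_power_arg (z : C) : cabs (power_arg z) = (cabs z / d.+1%:R) ^+ d.+1.
Proof.
rewrite /power_arg cabsX cabsM; congr ((_ * _) ^+ _).
by rewrite -[in LHS](rmorph_nat (real_complex R)) -fmorphV cabs_real ger0_norm// invr_ge0.
Qed.

Lemma power_arg_real (x : R) : power_arg x%:C = ((x / d.+1%:R) ^+ d.+1)%:C.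
Proof. by rewrite rmorphXn rmorphM/= fmorphV rmorph_nat. Qed.

End HyperBesselDerivative.

(** * The radius of starlikeness and its bounds *)

Theorem theorem1 (R : realType) (d : nat) (hd : (1 <= d)%N)
    (alpha : 'I_d -> R) (halpha : forall i : 'I_d, -1 < alpha i) :
  exists r : R,
    [/\ starlikeness_radius (hyper_bessel_f alpha) = r%:E,
        is_smallest_positive_root
          (fun z : Cplx R =>
             z * derive1 (hyper_bessel alpha) z + hyper_bessel alpha z) r,
        r < (d.+1%:R ^+ d * prodA alpha) `^ (d.+1%:R^-1),
        d.+1%:R ^+ d.+1 * prodA alpha / d.+2%:R < r ^+ d.+1 &
        r ^+ d.+1 < d.+2%:R * d.+1%:R ^+ d.+1 * prodA alpha * prodB alpha
          / (d.+2%:R ^+ 2 * prodB alpha - (2 * d + 3)%N%:R * prodA alpha)].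
Proof.
have m_gt1 : (1 < d.+1)%N by [].
have beta_gt0 := hbeta_gt0 halpha.
pose psi := psi d.+1 (hbeta alpha).
have epsi : exp_bounded psi by exact: exp_bounded_psi.
have := first_zero_Psi m_gt1 (erefl : hbeta alpha 0 = 1) beta_gt0.
rewrite (prod_hbeta alpha id) (prod_hbeta alpha (fun b => b + 1)) -/(prodA alpha).
have -> : \prod_(i < d) (alpha i + 1 + 1) = prodB alpha.
  by apply: eq_bigr => i _; rewrite -addrA.
rewrite natr1 -/psi => -[rho [rho_lo rho_hi1 rho_hi2 Psi_rho Psi_lt]].
pose k : R := d.+1%:R; have k0 : 0 < k by rewrite ltr0n.
have A0 : 0 < prodA alpha by apply: prodr_gt0 => i _; rewrite -ltrBlDr sub0r.
have rho0 : 0 < rho by apply: lt_trans rho_lo; rewrite divr_gt0.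
have kk0 : 0 < k ^+ d.+1 by rewrite exprn_gt0.
(* The positive [r] at which [w = (r / k) ^ (d + 1)] equals [rho]. *)
pose r := (k ^+ d.+1 * rho) `^ k^-1.
have r0 : 0 < r by rewrite powR_gt0// mulr_gt0.
have rk : r ^+ d.+1 = k ^+ d.+1 * rho.
  rewrite -powR_mulrn ?powR_ge0// -powRrM mulVf ?gt_eqF// powRr1//.
  by rewrite ltW// mulr_gt0.
have rkrho : (r / k) ^+ d.+1 = rho by rewrite expr_div_n rk mulrAC divff ?mul1r// gt_eqF.
have pow_lt (s : R) : 0 <= s -> ((s / k) ^+ d.+1 < rho) = (s < r).
  move=> s0; rewrite -rkrho ltr_pXn2r// ?nnegrE ?divr_ge0 ?(ltW k0) ?(ltW r0)//.
  by rewrite ltr_pM2r// invr_gt0.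
have root_r : csum psi (power_arg d r%:C) = 0.
  by rewrite power_arg_real csum_real// rkrho Psi_rho.
exists r; split.
- apply/eqP; rewrite eq_le; apply/andP; split.
    (* A disc of radius larger than [r] contains the point [r], where [f'] vanishes and the quotient
       is [0], not positive. *)
    apply: ge_ereal_sup => _ [r' [r'0 star] <-]; rewrite lee_fin leNgt; apply/negP => rr'.
    have [|_] := star r%:C; first by rewrite cabsE cabs_real ltcR gtr0_norm.
    rewrite /starlike_quotient ifF; last first.
      by rewrite -(rmorph0 (real_complex R)) (inj_eq (@complexI R)) gt_eqF.
    by rewrite derive1_hyper_bessel_f// root_r mulr0 mul0r ltxx.
  (* Conversely [|z| < r] means [|w| < rho], and [Psi] is positive on [[0, |w|]]. *)
  apply: ereal_sup_ubound; exists r => //; split=> // z; rewrite cabsE ltcR => zr.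
  have [phi0 quot] : csum (phi d.+1 (hbeta alpha)) (power_arg d z) != 0 /\
      0 < complex.Re (csum psi (power_arg d z) / csum (phi d.+1 (hbeta alpha)) (power_arg d z)).
    apply: csum_psi_div_phi => // x /andP[x0 xz]; apply: Psi_lt; rewrite x0/=.
    by apply: (le_lt_trans xz); rewrite cabs_power_arg pow_lt// cabs_ge0.
  rewrite /starlike_quotient; split=> [z0|].
    by rewrite /hyper_bessel_f hyper_bessel_csum mulf_neq0.
  case: eqVneq => [_|z0]; first by rewrite /= ltr01.
  by rewrite derive1_hyper_bessel_f// /hyper_bessel_f hyper_bessel_csum -mulf_div divff// mul1r.
- split=> //; first by rewrite derive1_hyper_bessel.
  move=> s s0; rewrite derive1_hyper_bessel// power_arg_real csum_real// => /complexI Psis.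
  rewrite leNgt -pow_lt ?ltW//; apply/negP => srho.
  have : 0 < psum psi ((s / k) ^+ d.+1).
    by apply: Psi_lt; rewrite srho andbT exprn_ge0// divr_ge0// ltW.
  by rewrite Psis ltxx.
(* Comparing the radicands [k ^ (d + 1) * rho] and [k ^ d * A] reduces to [k * rho < A]. *)
- apply: gt0_ltr_powR; rewrite ?invr_gt0 ?nnegrE ?mulr_ge0 ?exprn_ge0 ?(ltW k0) ?(ltW A0) ?(ltW rho0)//.
  by rewrite exprSr -mulrA ltr_pM2l// exprn_gt0.
- by rewrite rk -mulrA ltr_pM2l.
- rewrite rk; apply: (@lt_le_trans _ _ (k ^+ d.+1 * (d.+2%:R * prodA alpha * prodB alpha /
    (d.+2%:R ^+ 2 * prodB alpha - (2 * k + 1) * prodA alpha)))); first by rewrite ltr_pM2l.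
  have -> : (2 * d + 3)%N%:R = 2 * k + 1 by rewrite /k -natrM natr1; congr (_%:R); lia.
  by rewrite mulrA !mulrA [k ^+ _ * _]mulrC.
Qed.
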